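(* Let $A\in\mathbb C^{n\times n}$; let $z_1,z_2,\dots,z_N\in\mathbb C$ be arbitrary (possibly repeated) points of interpolation; let $f$ be an analytic function defined on a neighborhood of the convex hull of the union of the spectrum $\sigma(A)$ and the set $\{z_1,\dots,z_N\}$; let $r=\frac uv$ be a rational function of degree $[L/M]$, with $L\le N-1$, that interpolates $f$ at the points $z_1,\dots,z_N$ (counted according to their multiplicities); and let $v(z_k)\ne0$ for $k=1,2,\dots,N$ and $v(\lambda)\neq0$ for all $\lambda\in\sigma(A)$. Put $\Omega(z)=\prod_{k=1}^N(z-z_k)$. Then for any linear functional $\xi$ on the linear space $\mathbb C^{n\times n}$, $$\bigl|\xi\bigl[f(A)-r(A)\bigr]\bigr|\le\max_{\substack{t\in[0,1]\\ \mu\in\operatorname{co}\{z_1,z_2,\dots,z_N\}}}\biggl|\xi\biggl[\Omega(A)[v(A)]^{-1}\frac{(vf)^{(N)}\bigl((1-t)\mu\mathbf 1+tA\bigr)}{N!}\biggr]\biggr|.$$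
   Context: $\mathbf 1$ is the identity matrix and $\operatorname{co}M$ is the convex hull of $M\subset\mathbb C$. If $g$ is analytic on an open (possibly disconnected) set containing $\sigma(B)$, then $g(B)=\frac1{2\pi i}\int_\Gamma g(\lambda)(\lambda\mathbf 1-B)^{-1}d\lambda$, where the contour $\Gamma$ encloses $\sigma(B)$; $(vf)^{(N)}$ is the $N$-th complex derivative of the product $vf$, and it is applied to the matrix $(1-t)\mu\mathbf 1+tA$ in this sense. A rational function $r=u/v$ of degree $[L/M]$ means that $u,v$ are polynomials with $\deg u\le L$, $\deg v\le M$. ''$r$ interpolates $f$ at $z_1,\dots,z_N$ counted according to their multiplicities'' means: if $\zeta_1,\dots,\zeta_m$ are the distinct values in the list $z_1,\dots,z_N$ and $n_k$ is the number of occurrences of $\zeta_k$ in the list (so $N=\sum_k n_k$), then $r^{(j)}(\zeta_k)=f^{(j)}(\zeta_k)$ for $k=1,\dots,m$, $j=0,1,\dots,n_k-1$. *)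

(* Defs.v *)
(* The complex numbers are R[i] for R : realType. *)
From HB Require Import structures.
From mathcomp Require Export all_boot all_order all_algebra.
From mathcomp Require Export complex.
From mathcomp Require Export all_classical all_reals all_analysis.

Set Implicit Arguments.
Unset Strict Implicit.
Unset Printing Implicit Defensive.

Export Order.TTheory GRing.Theory Num.Theory.
Export numFieldNormedType.Exports.

Global Open Scope classical_set_scope.
Global Open Scope complex_scope.
Global Open Scope ring_scope.

(* R[i]^o is R[i] as a normed module over itself: it carries the topology.
   The coefficients of a convex combination are the elements l of R[i] with
   0 <= l <= 1 for the partial order of R[i], which are exactly the real ones. *)
Definition convex_hull (R : realType) (S : set R[i]) : set R[i] :=
  smallest (@convex_set R[i] R[i]^o) S.

Definition analytic_on (R : realType) (D : set R[i]) (f : R[i] -> R[i]) : Prop :=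
  forall z0, D z0 -> exists a : nat -> R[i],
    \forall z \near (z0 : R[i]^o),
      [series (a k * (z - z0) ^+ k : R[i]^o)]_k @ \oo --> (f z : R[i]^o).

Definition cderiven (R : realType) (k : nat) (f : R[i] -> R[i]) : R[i] -> R[i] :=
  derive1n k (f : R[i]^o -> R[i]^o).

Definition spectrum (R : realType) (n : nat) (B : 'M[R[i]]_n) : set R[i] :=
  [set a | eigenvalue B a].

Definition cintegral (R : realType) (a b : R) (h : R -> R[i]) : R[i] :=
  (\int[lebesgue_measure]_(t in `[a, b]) complex.Re (h t))%R +i*
  (\int[lebesgue_measure]_(t in `[a, b]) complex.Im (h t))%R.

(* The circle is traversed once counterclockwise, t |-> c + r e^{it}. *)
Definition circle_integral (R : realType) (c : R[i]) (r : R) (h : R[i] -> R[i]) :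
    R[i] :=
  cintegral 0 (pi *+ 2) (fun t : R =>
    h (c + r%:C * (cos t +i* sin t)) * (r%:C * (- sin t +i* cos t))).

Definition closed_disc (R : realType) (c : R[i] * R) : set R[i] :=
  [set w | `|w - c.1| <= c.2%:C].

Definition open_disc (R : realType) (c : R[i] * R) : set R[i] :=
  [set w | `|w - c.1| < c.2%:C].

(* A contour in D around the spectrum of B is the positively oriented boundary
   of a finite disjoint union of closed discs (center, radius) that are contained
   in D and whose interiors cover the spectrum. Several discs are needed, since D
   may be disconnected. *)
Definition encloses_spectrum (R : realType) (n : nat) (D : set R[i])
    (B : 'M[R[i]]_n) (G : seq (R[i] * R)) : Prop :=
  [/\ forall c, c \in G -> 0 < c.2 /\ closed_disc c `<=` D,
      pairwise (fun c c' => `[< closed_disc c `&` closed_disc c' = set0 >]) G &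
      spectrum B `<=` \bigcup_(c in [set` G]) open_disc c].

(* (2 i pi)^-1 times the integral of g(w) (w 1 - B)^-1 along the contour. *)
Definition contour_matfun (R : realType) (n : nat) (G : seq (R[i] * R))
    (g : R[i] -> R[i]) (B : 'M[R[i]]_n) : 'M[R[i]]_n :=
  \matrix_(i, j) (((0 +i* (pi *+ 2))^-1) * \sum_(c <- G)
    circle_integral c.1 c.2 (fun w => g w * invmx (w%:M - B) i j)).

(* g(B) for g analytic on the open set D containing the spectrum of B: the value
   of the integral for some contour in D around the spectrum. For analytic g this
   value does not depend on the contour. *)
Definition matfun (R : realType) (n : nat) (D : set R[i])
    (g : R[i] -> R[i]) (B : 'M[R[i]]_n) : 'M[R[i]]_n :=
  xget 0 [set X | exists2 G, encloses_spectrum D B G & X = contour_matfun G g B].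

Definition interpolates (R : realType) (r f : R[i] -> R[i]) (z : seq R[i]) :
    Prop :=
  forall zeta j, zeta \in z -> (j < count_mem zeta z)%N ->
    cderiven j r zeta = cderiven j f zeta.

(* Main.v *)
(* Write g[z_1, ..., z_j, x] for the divided differences of g = v f - u, that is,
   G_0 = g and G_j(x) = (G_(j-1)(x) - G_(j-1)(z_j)) / (x - z_j) with the
   singularity removed. Since u interpolates v f, g = Omega G_N, and therefore
   f(A) - r(A) = Omega(A) v(A)^-1 G_N(A). It remains to bound
   Phi(G_N) = xi[Omega(A) v(A)^-1 G_N(A)]. Differentiating
   (x - z_j) G_j(x) = G_(j-1)(x) - G_(j-1)(z_j) gives
     d/ds [s^(m+1) G_j^(m)(z_j + s (y - z_j))] = s^m G_(j-1)^(m+1)(z_j + s (y - z_j)),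
   so a bound K for |Phi(G_(j-1)^(m+1) o a)| over all affine maps
   a(x) = (1 - t) mu + t x yields the bound K / (m+1) for |Phi(G_j^(m) o a)|;
   after N steps only the factor 1 / N! is left, and g^(N) = (v f)^(N) because
   deg u < N. This replaces the integral of the Hermite-Genocchi formula by N
   applications of the mean value inequality.

   The contour integral g(B) is p(B) as soon as g = p + chi_B q on D with p a
   polynomial and q continuously differentiable: chi_B(w) (w - B)^-1 is a
   polynomial, so the part with q vanishes by Cauchy's theorem on discs. Repeated
   removal of singularities, at the eigenvalues of B, gives such p and q, and
   shows that Phi(G) is a linear combination of derivatives of G at these
   eigenvalues. *)
Require Import Defs.
From mathcomp Require Import ring lra.

Set Implicit Arguments.
Unset Strict Implicit.
Unset Printing Implicit Defensive.

(** * Caratheodory derivatives *)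

(** Divided differences have to be differentiated as often as wanted, so a function is carried
    together with a list of all its derivatives ([family]), and removing a singularity acts on the
    whole list by an explicit formula. Analyticity of [f] serves only to produce the first list from
    its power series; the smoothness of the quotients is then a mean value estimate, and Cauchy's
    theorem is needed only for C1 functions on discs. The contour calculus is never shown to be
    multiplicative. Product identities are read instead as congruences modulo [char_poly A] between
    polynomials, on which [horner_mx] is multiplicative. Phi is turned into a finite jet at the
    eigenvalues of [A], with coefficients independent of the function. The same Phi thus applies to
    G_j composed with an affine map, as a finite sum of values along segments, and the mean value
    inequality bounds this sum as a whole, which a termwise estimate could not do. The class of
    affine maps is stable: contracting (1 - t) mu + t x towards a node z_j gives a map of the same
    shape, with s t in place of t and another point of the hull in place of mu. *)

Section Caratheodory.
Variables (K : numFieldType) (T : topologicalType) (io : T -> K).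
Implicit Types (f g phi : T -> K) (x y : T) (d e : K).

(* Caratheodory's form of the derivative, for functions of a parameter embedded
   in K by io: io = id gives the complex derivative, and io = %:C : R -> C the
   derivative of a complex function of a real variable. *)
Definition cder f x d := exists phi, [/\ {for x, continuous phi}, phi x = d &
  \forall y \near x, f y = f x + phi y * (io y - io x)].

Lemma cder_continuous f x d :
  {for x, continuous io} -> cder f x d -> {for x, continuous f}.
Proof.
move=> cio [phi [cphi _ fE]].
have cg : (fun y => f x + phi y * (io y - io x)) @ x --> f x.
  rewrite -[X in _ --> X](_ : f x + phi x * (io x - io x) = _); last first.
    by rewrite subrr mulr0 addr0.
  apply: cvgD; first exact: cvg_cst.
  apply: cvgM; first exact: cphi.
  by apply: cvgB; [exact: cio|exact: cvg_cst].
apply: cvg_trans cg; apply: near_eq_cvg.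
by near=> y; apply/esym; near: y.
Unshelve. all: by end_near. Qed.

Lemma near_cder f g x d :
  (\forall y \near x, f y = g y) -> cder f x d -> cder g x d.
Proof.
move=> fg [phi [cphi phix fE]]; exists phi; split=> //.
have fgx := nbhs_singleton fg.
near=> y; rewrite -fgx; transitivity (f y); [apply/esym|]; by near: y.
Unshelve. all: by end_near. Qed.

Lemma eq_cder f g x d : f =1 g -> cder f x d -> cder g x d.
Proof. by move=> /funext ->. Qed.

Lemma cder_eq f x d e : d = e -> cder f x d -> cder f x e.
Proof. by move=> ->. Qed.

Lemma cder_cst x e : cder (cst e) x 0.
Proof.
exists (cst 0); split=> //; first exact: cst_continuous.
by apply: nearW => y /=; rewrite mul0r addr0.
Qed.

Lemma cder_io x : cder io x 1.
Proof.
exists (cst 1); split=> //; first exact: cst_continuous.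
by apply: nearW => y /=; rewrite mul1r addrC subrK.
Qed.

Lemma cderD f g x d e :
  cder f x d -> cder g x e -> cder (fun y => f y + g y) x (d + e).
Proof.
move=> [p [cp px fE]] [q [cq qx gE]]; exists (fun y => p y + q y).
split; [by apply: cvgD|by rewrite px qx|].
by near=> y; rewrite (near fE y) // (near gE y) // mulrDl addrACA.
Unshelve. all: by end_near. Qed.

Hypothesis io_continuous : continuous io.

Lemma cderM f g x d e : cder f x d -> cder g x e ->
  cder (fun y => f y * g y) x (d * g x + f x * e).
Proof.
move=> df dg; have cg := cder_continuous (@io_continuous x) dg.
move: df dg => [p [cp px fE]] [q [cq qx gE]].
exists (fun y => p y * g y + f x * q y).
split; [|by rewrite px qx|].
  by apply: cvgD; apply: cvgM => //; exact: cvg_cst.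
near=> y.
have fy : f y = f x + p y * (io y - io x) by near: y.
have gy : g y = g x + q y * (io y - io x) by near: y.
by rewrite fy gy; ring.
Unshelve. all: by end_near. Qed.

Lemma cderZ e f x d : cder f x d -> cder (fun y => e * f y) x (e * d).
Proof. by move=> /(cderM (cder_cst x e)); rewrite mul0r add0r. Qed.

Lemma cderN f x d : cder f x d -> cder (fun y => - f y) x (- d).
Proof.
move=> /(cderZ (-1)); rewrite mulN1r; apply: eq_cder => y; rewrite mulN1r //.
Qed.

Lemma cderB f g x d e :
  cder f x d -> cder g x e -> cder (fun y => f y - g y) x (d - e).
Proof. by move=> df dg; apply: cderD => //; exact: cderN. Qed.

Lemma cder_sum (I : eqType) (s : seq I) (F : I -> T -> K) (G : I -> K) x :
  (forall i, i \in s -> cder (F i) x (G i)) ->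
  cder (fun y => \sum_(i <- s) F i y) x (\sum_(i <- s) G i).
Proof.
elim: s => [|i s IH] FG.
  rewrite big_nil; apply: eq_cder _ (cder_cst x 0) => y; rewrite big_nil //.
rewrite big_cons.
have /(cderD (FG i (mem_head _ _))) : cder (fun y => \sum_(i <- s) F i y) x
    (\sum_(i <- s) G i).
  by apply: IH => j js; apply: FG; rewrite in_cons js orbT.
by apply: eq_cder => y; rewrite big_cons.
Qed.

Lemma cderV f x d : f x != 0 -> cder f x d ->
  cder (fun y => (f y)^-1) x (- d / f x ^+ 2).
Proof.
move=> fx0 df; have cf := cder_continuous (@io_continuous x) df.
move: df => [p [cp px fE]].
exists (fun y => - p y / (f y * f x)); split; [|by rewrite px expr2|].
  apply: cvgM; first exact: cvgN.
  apply: cvgV; first by rewrite mulf_neq0.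
  by apply: cvgM; [exact: cf|exact: cvg_cst].
have fy0 : \forall y \near x, f y != 0.
  by apply: (cvgr_neq0 _ cf).
near=> y.
have fy0' : f y != 0 by near: y.
have fy : f y - f x = p y * (io y - io x).
  by apply/eqP; rewrite subr_eq addrC; apply/eqP; near: y.
rewrite mulrAC mulNr -fy; field; exact/andP.
Unshelve. all: by end_near. Qed.

Lemma cderX f n x d : cder f x d ->
  cder (fun y => f y ^+ n) x (d * f x ^+ n.-1 *+ n).
Proof.
move=> df; elim: n => [|n IH]; first by rewrite mulr0n; exact: cder_cst.
rewrite [X in cder X](_ : _ = fun y => f y * f y ^+ n); last first.
  by apply/funext => y; rewrite exprS.
rewrite [X in cder _ _ X](_ : _ = d * f x ^+ n + f x * (d * f x ^+ n.-1 *+ n)).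
  exact: cderM.
case: n {IH} => [|n] /=; first by rewrite mulr0n mulr0 addr0.
by rewrite mulrnAr mulrCA -exprS -mulrS.
Qed.

End Caratheodory.

Lemma cder_comp (K : numFieldType) (T : topologicalType) (io : T -> K) f
    (g : K -> K) x d e :
  continuous io -> cder io f x d -> cder id g (f x) e ->
  cder io (fun y => g (f y)) x (e * d).
Proof.
move=> cio df; have cf := cder_continuous (@cio x) df.
move: df => [p [cp px fE]] [q [cq qx gE]].
exists (fun y => q (f y) * p y); split; [|by rewrite px qx|].
  apply: cvgM => //.
  exact: (cvg_comp _ _ cf).
have {}gE : \forall y \near x, g (f y) = g (f x) + q (f y) * (f y - f x).
  exact: (cf _ gE).
near=> y.
have fy : f y - f x = p y * (io y - io x).
  by apply/eqP; rewrite subr_eq addrC; apply/eqP; near: y.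
by rewrite -mulrA -fy; near: y.
Unshelve. all: by end_near. Qed.

(** * Agreement with the library derivative *)

Section complex_derivative.
Variable K : numFieldType.
Implicit Types (f : K -> K) (x d : K).

Lemma cder_is_derive f x d : cder id f x d -> is_derive x 1 f d.
Proof.
move=> [p [cp px fE]].
have c0 : h + x @[h --> (0:K)] --> x.
  have /cvgD/(_ (cvg_cst x)) : h @[h --> (0:K)] --> (0:K) by exact: cvg_id.
  by rewrite add0r.
have lim_f : h^-1 *: ((f \o shift x) (h *: 1) - f x) @[h --> 0^'] --> d.
  have cp0 : p (h + x) @[h --> 0^'] --> d.
    have : p (h + x) @[h --> (0:K)] --> p x by exact: (cvg_comp _ p c0 cp).
    by rewrite px => ph; move=> B /ph; exact: nbhs_dnbhs.
  apply: cvg_trans cp0; apply: near_eq_cvg.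
  have fE' : \forall h \near 0^', f (h + x) = f x + p (h + x) * h.
    apply: nbhs_dnbhs.
    have fE0 : \forall h \near (0:K), f (h + x) = f x + p (h + x) * (h + x - x).
      exact: c0 _ fE.
    by near=> h; rewrite (near fE0 h) // addrK.
  near=> h.
  have h0 : h != 0 by near: h; exact: nbhs_dnbhs_neq.
  rewrite /= [h *: 1]mulr1 (near fE' h) // addrAC subrr add0r.
  by rewrite [_ *: _]mulrC mulfK.
apply: DeriveDef; first by apply/cvg_ex; exists d.
exact/cvg_lim.
Unshelve. all: by end_near. Qed.

Lemma is_derive_cder f x d : is_derive x 1 f d -> cder id f x d.
Proof.
move=> [df dfE].
pose p y := if y == x then d else (f y - f x) / (y - x).
have fE : \forall y \near x, f y = f x + p y * (y - x).
  near=> y; rewrite /p; case: eqVneq => [->|yx].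
    by rewrite subrr mulr0 addr0.
  by rewrite divfK ?subr_eq0 // addrC subrK.
suff cp : p y @[y --> x] --> p x.
  by exists p; split; [exact: cp|by rewrite /p eqxx|exact: fE].
have lim_f : h^-1 *: ((f \o shift x) (h *: 1) - f x) @[h --> 0^'] --> d.
  by rewrite -dfE; exact: df.
apply: (iffRL (@cvgrPdist_lt _ K _ (nbhs x) _ p (p x))) => e e0.
have -> : p x = d by rewrite /p eqxx.
move/cvgrPdist_lt: lim_f => /(_ e e0) lim_f.
have : \forall h \near (0 : K)^', `|d - p (h + x)| < e.
  near=> h.
  have h0 : h != 0 by near: h; exact: nbhs_dnbhs_neq.
  have : `|d - h^-1 *: ((f \o shift x) (h *: 1) - f x)| < e by near: h.
  rewrite /= [h *: 1]mulr1 /p -subr_eq0 addrK (negbTE h0).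
  by rewrite [_ *: _]mulrC.
rewrite /dnbhs /within near_simpl /= => /nbhs_ballP[r /= r0 rP];
  apply/nbhs_ballP; exists r => //= y.
rewrite -ball_normE /= => xy; have [->|yx] := eqVneq y x.
  by rewrite /p eqxx subrr normr0.
rewrite -[y](subrK x); apply: rP; last by rewrite /= subr_eq0.
by rewrite -ball_normE /= sub0r opprB.
Unshelve. all: by end_near. Qed.

End complex_derivative.

(* R[i] carries a topology only as R[i]^o; as an abstract numFieldType it gets
   the same topology by inference. *)
Definition CC (R : realType) : numFieldType := R[i].

(** * Real moduli and the mean value inequality for complex values *)

Section complex_plane.
Variable R : realType.
Local Notation C := (CC R).
Local Notation Re := (@complex.Re R).
Local Notation Im := (@complex.Im R).

(** The norm of [R[i]] takes its values in [R[i]]; this is the same modulus as an element of the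
    totally ordered field [R]. *)
Definition cabs (x : C) : R := Re `|x|.

Lemma normCE (x : C) : `|x| = (cabs x)%:C.
Proof. by rewrite /cabs [`|x|]normc_def. Qed.

Lemma cabs_ge0 x : 0 <= cabs x.
Proof. by rewrite -ler0c -normCE normr_ge0. Qed.

Lemma cabsM x y : cabs (x * y) = cabs x * cabs y.
Proof. by apply: complexI; rewrite rmorphM -!normCE /= normrM. Qed.

Lemma ler_cabsD x y : cabs (x + y) <= cabs x + cabs y.
Proof. by rewrite -lecR rmorphD -!normCE ler_normD. Qed.

Lemma cabsN x : cabs (- x) = cabs x.
Proof. by rewrite /cabs normrN. Qed.

Lemma cabs0 : cabs 0 = 0.
Proof. by rewrite /cabs normr0. Qed.

Lemma cabs1 : cabs 1 = 1.
Proof. by rewrite /cabs normr1. Qed.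

Lemma cabs_eq0 x : (cabs x == 0) = (x == 0).
Proof. by rewrite -(inj_eq (@complexI R)) -normCE normr_eq0. Qed.

Lemma cabs_gt0 x : (0 < cabs x) = (x != 0).
Proof. by rewrite lt_def cabs_eq0 cabs_ge0 andbT. Qed.

Lemma cabsX x n : cabs (x ^+ n) = cabs x ^+ n.
Proof.
elim: n => [|n IH]; first by rewrite !expr0 cabs1.
by rewrite !exprS cabsM IH.
Qed.

Lemma cabsV x : cabs x^-1 = (cabs x)^-1.
Proof. by apply: complexI; rewrite fmorphV -!normCE normfV. Qed.

Lemma cabsR (r : R) : cabs r%:C = `|r|.
Proof.
by apply: complexI; rewrite -normCE [LHS]normc_def /= expr0n addr0 sqrtr_sqr.
Qed.

Lemma cabs_nat n : cabs n%:R = n%:R.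
Proof.
by rewrite -[n%:R](rmorph_nat (@real_complex_def R (Phant R))) cabsR normr_nat.
Qed.

Lemma Re_le_cabs x : `|Re x| <= cabs x.
Proof. by rewrite -lecR -normCE; exact: normc_ge_Re. Qed.

Lemma Im_le_cabs x : `|Im x| <= cabs x.
Proof.
have := Re_le_cabs ('i * x); rewrite cabsM [_ * x]mulrC ReiNIm normrN.
suff -> : cabs 'i = 1 by rewrite mul1r.
by apply: complexI; rewrite -normCE [LHS]normc_def /= expr0n add0r expr1n sqrtr1.
Qed.

Lemma cabs_le_ReIm x : cabs x <= `|Re x| + `|Im x|.
Proof.
rewrite [x in cabs x]complexE (le_trans (ler_cabsD _ _))// cabsR lerD2l.
rewrite cabsM cabsR -[leRHS]mul1r ler_wpM2r //.
suff -> : cabs 'i = 1 by [].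
by apply: complexI; rewrite -normCE [LHS]normc_def /= expr0n add0r expr1n sqrtr1.
Qed.

Lemma ler_cabs_sum (I : Type) (s : seq I) (F : I -> C) :
  cabs (\sum_(i <- s) F i) <= \sum_(i <- s) cabs (F i).
Proof.
elim: s => [|i s IH]; first by rewrite !big_nil cabs0.
by rewrite !big_cons (le_trans (ler_cabsD _ _))// lerD2l.
Qed.

Lemma gtC0E (e : C) : 0 < e -> 0 < Re e /\ e = (Re e)%:C.
Proof.
move: e => [a b] /=; rewrite ltcE /= => /andP[/eqP -> a0]; by [].
Qed.

Lemma nbhsC (x : C) (P : set C) :
  nbhs x P <-> exists2 e : R, 0 < e & forall y, cabs (y - x) < e -> P y.
Proof.
split=> [/nbhs_ballP[e /= /gtC0E[e0 ->] eP]|[e e0 eP]].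
  exists (Re e) => // y; rewrite -ltcR -normCE distrC => xy.
  by apply: eP; rewrite -ball_normE.
apply/nbhs_ballP; exists e%:C; first by rewrite /= ltcR.
move=> y; rewrite -ball_normE /= distrC normCE ltcR; exact: eP.
Qed.

Lemma RtoC_continuous : continuous (fun t : R => t%:C : C).
Proof.
move=> t; apply/cvgrPdist_lt => e /gtC0E[e0 ->].
apply/nbhs_ballP; exists (Re e); [exact: e0|move=> s ts].
have {}ts : `|t - s| < Re e by exact: ts.
by rewrite /= -rmorphB /= normCE cabsR ltcR.
Qed.

Lemma cvgCP (T : Type) (F : set_system T) {FF : Filter F} (f : T -> C) (l : C) :
  f @ F --> l <-> forall e : R, 0 < e -> \forall t \near F, cabs (l - f t) < e.
Proof.
split=> [/cvgrPdist_lt fl e e0|fl].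
  have /fl : 0 < (e%:C : C) by rewrite ltcR.
  by apply: filterS => t; rewrite normCE ltcR.
apply/cvgrPdist_lt => e /gtC0E[e0 ->]; apply: filterS (fl _ e0) => t.
by rewrite normCE ltcR.
Qed.

Lemma Re_continuous : continuous (fun x : C => Re x).
Proof.
move=> x; apply: (iffRL (@cvgrPdist_lt _ R _ (nbhs x) _ _ _)) => e e0.
apply/nbhsC; exists e => // y; rewrite -cabsN opprB; apply: le_lt_trans.
by rewrite -raddfB; exact: Re_le_cabs.
Qed.

Lemma Im_continuous : continuous (fun x : C => Im x).
Proof.
move=> x; apply: (iffRL (@cvgrPdist_lt _ R _ (nbhs x) _ _ _)) => e e0.
apply/nbhsC; exists e => // y; rewrite -cabsN opprB; apply: le_lt_trans.
by rewrite -raddfB; exact: Im_le_cabs.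
Qed.

Lemma cabs_continuous : continuous cabs.
Proof.
move=> x; apply: (@cvg_comp _ _ _ (fun x : C => `|x|) Re _ (nbhs (`|x|))).
  exact: norm_continuous.
exact: Re_continuous.
Qed.

Lemma cvgC_ReIm (T : Type) (F : set_system T) {FF : Filter F} (f : T -> C) (l : C) :
  Re (f t) @[t --> F] --> Re l -> Im (f t) @[t --> F] --> Im l -> f @ F --> l.
Proof.
move=> /cvgrPdist_lt fR /cvgrPdist_lt fI; apply/cvgCP => e e0.
have e2 : 0 < e / 2 by rewrite divr_gt0.
near=> t; rewrite (le_lt_trans (cabs_le_ReIm _))// !raddfB /= (splitr e) ltrD//.
  by near: t; exact: fR.
by near: t; exact: fI.
Unshelve. all: by end_near. Qed.

Definition RC (t : R) : C := t%:C.

Lemma cder_Re (f : R -> C) t d :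
  cder RC f t d -> is_derive t 1 (fun s => Re (f s)) (Re d).
Proof.
move=> [p [cp px fE]]; apply: cder_is_derive.
exists (Re \o p); split; [|by rewrite /= px|].
  by apply: cvg_comp cp _; exact: Re_continuous.
apply: filterS fE => s ->; rewrite /= raddfD /RC -rmorphB /=; congr (_ + _).
by case: (p s) => a b /=; rewrite mulr0 subr0.
Qed.

Lemma cder_Im (f : R -> C) t d :
  cder RC f t d -> is_derive t 1 (fun s => Im (f s)) (Im d).
Proof.
move=> [p [cp px fE]]; apply: cder_is_derive.
exists (Im \o p); split; [|by rewrite /= px|].
  by apply: cvg_comp cp _; exact: Im_continuous.
apply: filterS fE => s ->; rewrite /= raddfD /RC -rmorphB /=; congr (_ + _).
by case: (p s) => a b /=; rewrite mulr0 add0r.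
Qed.

Lemma cder_ReIm (f : R -> C) (t a b : R) :
  is_derive t (1 : R) (fun s => Re (f s)) a ->
  is_derive t (1 : R) (fun s => Im (f s)) b ->
  cder RC f t (a +i* b).
Proof.
move=> /is_derive_cder[p [cp px fR]] /is_derive_cder[q [cq qx fI]].
exists (fun s => p s +i* q s); split; [|by rewrite px qx|].
  by apply: cvgC_ReIm.
near=> s; rewrite /RC -rmorphB [f s]complexE [f t]complexE (near fR s) //.
rewrite (near fI s) // [p s +i* _]complexE /= !rmorphD !rmorphM /=.
by ring.
Unshelve. all: by end_near. Qed.

(** A rotation reduces this to a real statement: if k has modulus one and k (f 1 - f 0) is the
    modulus of f 1 - f 0, then g - Re (k f) has a nonnegative derivative. *)
Lemma mean_value (f f' : R -> C) (g g' : R -> R) :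
  (forall t : R, 0 <= t <= 1 -> cder RC f t (f' t)) ->
  (forall t : R, 0 <= t <= 1 -> is_derive t 1 g (g' t)) ->
  (forall t : R, 0 <= t <= 1 -> cabs (f' t) <= g' t) ->
  cabs (f 1 - f 0) <= g 1 - g 0.
Proof.
move=> df dg fg.
(* Division by zero gives [k] = 0 when [D] = 0, so only [cabs k <= 1] is shown; this is enough. *)
pose D := f 1 - f 0; pose k : C := (D : R[i])^*%C / `|D|.
have kD : k * D = `|D|.
  have [D0|D0] := eqVneq D 0; first by rewrite D0 normr0 mulr0.
  rewrite /k mulrAC [_^* * _]mulrC -[D * _]sqr_normc expr2 mulfK //.
  by rewrite normr_eq0.
have k1 : cabs k <= 1.
  rewrite -lecR -normCE /k normrM normfV normr_id [`|_^*|]normcJ.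
  have [->|D0] := eqVneq D 0; first by rewrite normr0 mul0r.
  by rewrite divff // normr_eq0.
pose h t := g t - Re (k * f t).
pose h' t := g' t - Re (k * f' t).
have dh (t : R) : 0 <= t <= 1 -> is_derive t 1 h (h' t).
  move=> t01; have dgt := dg t t01.
  have dkf := cder_Re (cderZ RtoC_continuous k (df t t01)).
  exact: is_deriveB.
have [|||c] := @MVT_segment R h h' 0 1.
- by [].
- by move=> t /[!in_itv] /= /andP[/ltW t0 /ltW t1]; apply: dh; rewrite t0.
- apply: derivable_within_continuous => t /[!in_itv] /= t01.
  by have [] := dh t t01.
rewrite in_itv /= => c01; rewrite subr0 mulr1 => hE.
have : 0 <= h' c.
  rewrite subr_ge0 (le_trans (ler_norm _))// (le_trans (Re_le_cabs _))//.
  rewrite cabsM (le_trans _ (fg c c01))// -[leRHS]mul1r ler_wpM2r //.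
  exact: cabs_ge0.
have : Re (k * f 1) - Re (k * f 0) = cabs D.
  by rewrite -raddfB -mulrBr -/D kD normCE.
by rewrite -hE /h => <-; lra.
Qed.

(** The little-o form turns estimates into derivatives, at the centre of a divided difference and
    for sums of power series. *)
Lemma cder_eps (f : C -> C) x d : cder id f x d <-> forall e : R, 0 < e ->
  \forall y \near x, cabs (f y - f x - d * (y - x)) <= e * cabs (y - x).
Proof.
split=> [[p [cp px fE]] e e0|fd].
  have /cvgCP /(_ e e0) pe : p y @[y --> x] --> p x by exact: cp.
  near=> y; rewrite (near fE y) //= [f x + _]addrC addrK -mulrBl cabsM.
  rewrite ler_wpM2r ?cabs_ge0 // -px -cabsN opprB ltW //; by near: y.
pose p y := if y == x then d else (f y - f x) / (y - x).
have px : p x = d by rewrite /p eqxx.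
have fE : \forall y \near x, f y = f x + p y * (y - x).
  near=> y; rewrite /p; case: eqVneq => [->|yx].
    by rewrite subrr mulr0 addr0.
  by rewrite divfK ?subr_eq0 // addrC subrK.
exists p; split; [|exact: px|exact: fE].
apply: (iffRL (@cvgCP _ (nbhs x) (nbhs_filter x) p (p x))) => e e0; rewrite px.
have e2 : 0 < e / 2 by rewrite divr_gt0.
have fd2 := fd _ e2.
near=> y; rewrite /p; case: eqVneq => [_|yx]; first by rewrite subrr cabs0.
have yx0 : y - x != 0 by rewrite subr_eq0.
rewrite -cabsN opprB -(mulfK yx0 d) -mulrBl cabsM cabsV.
rewrite ltr_pdivrMr ?cabs_gt0 //.
rewrite (@le_lt_trans _ _ (e / 2 * cabs (y - x))) //; first by near: y.
by rewrite ltr_pM2r ?cabs_gt0 // ltr_pdivrMr // ltr_pMr // ltr1n.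
Unshelve. all: by end_near. Qed.

End complex_plane.

(** * Removable singularities *)

Section families.
Variable K : numFieldType.
Implicit Types (D : set K) (F G : nat -> K -> K) (p v : {poly K}).

(** [F] lists a function and all its derivatives on [D], so that smoothness is data transformed by
    explicit formulas. Values outside [D] are unconstrained. *)
Definition family D F := forall k x, D x -> cder id (F k) x (F k.+1 x).

Lemma id_continuous : continuous (@id K).
Proof. by move=> x; exact: cvg_id. Qed.

Lemma family_shift D F n : family D F -> family D (fun k => F (n + k)%N).
Proof. by move=> dF k x Dx; rewrite addnS; exact: dF. Qed.

Lemma cder_horner p x : cder id (horner p) x p^`().[x].
Proof.
elim/poly_ind: p => [|p c IH].
  rewrite deriv0 horner0; apply: eq_cder _ (cder_cst _ _ 0) => y /=; rewrite
    horner0 //.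
rewrite derivD derivM derivX derivC addr0 mulr1 hornerD hornerM hornerX.
have := cderD (cderM id_continuous IH (cder_io id x)) (cder_cst id x c).
rewrite addr0 mulr1; apply: eq_cder => y /=; rewrite hornerMXaddC //.
Qed.

Definition fpoly p k x : K := p^`(k).[x].

Lemma family_poly D p : family D (fpoly p).
Proof. by move=> k x _; rewrite /fpoly derivnS; exact: cder_horner. Qed.

Definition fsub F G k x := F k x - G k x.

Lemma family_fsub D F G : family D F -> family D G -> family D (fsub F G).
Proof.
by move=> dF dG k x Dx; apply: (cderB id_continuous); [exact: dF|exact: dG].
Qed.

(** Leibniz's formula for the derivatives of a product. *)
Definition fmul F G k x := \sum_(i < k.+1) (F i x * G (k - i)%N x) *+ 'C(k, i).

Lemma family_fmul D F G : family D F -> family D G -> family D (fmul F G).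
Proof.
move=> dF dG k x Dx.
pose T i j := F i x * G j x.
(* Pascal's rule regroups the formula of order k + 1 as the termwise derivative of the formula of
   order k. *)
have -> : fmul F G k.+1 x =
    \sum_(i < k.+1) (T i.+1 (k - i)%N + T i (k - i).+1) *+ 'C(k, i).
  rewrite /fmul big_ord_recl bin0 subn0 mulr1n.
  under eq_bigr => i _ do rewrite lift0 subSS binS mulrnDr.
  rewrite big_split /= [X in _ + (X + _)](_ : _ =
      \sum_(i < k) (T i.+1 (k - i)%N) *+ 'C(k, i.+1)); last first.
    by rewrite big_ord_recr /= bin_small // mulr0n addr0.
  rewrite addrA.
  under [RHS]eq_bigr => i _ do rewrite mulrnDl.
  rewrite big_split /= addrC; congr (_ + _).
  rewrite big_ord_recl bin0 mulr1n subn0; congr (_ + _).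
  apply: eq_bigr => i _; by rewrite lift0 /T subnSK.
apply: (@eq_cder _ _ _ (fun y => \sum_(i < k.+1)
    (F i y * G (k - i)%N y) *+ 'C(k, i))) => //.
apply: (cder_sum (F := fun (i : 'I_k.+1) y => (F i y * G (k - i)%N y) *+ 'C(k, i))).
move=> i _; elim: 'C(k, i) => [|c IH].
  rewrite mulr0n; apply: eq_cder _ (cder_cst _ _ 0) => y; rewrite mulr0n //.
have := cderD (cderM id_continuous (dF i x Dx) (dG (k - i)%N x Dx)) IH.
rewrite mulrS; apply: eq_cder => y; rewrite mulrS //.
Qed.

(** The quotient rule (q / v ^ k)' = (q' v - k q v') / v ^ (k + 1) keeps the k-th derivative of p /
    v over the denominator v ^ (k + 1). *)
Fixpoint rat_num p v k : {poly K} :=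
  if k is k'.+1 then (rat_num p v k')^`() * v - (rat_num p v k' * v^`()) *+ k
  else p.

Definition frat p v k x := (rat_num p v k).[x] / v.[x] ^+ k.+1.

Lemma family_frat p v : family [set x | v.[x] != 0] (frat p v).
Proof.
move=> k x /= vx0; set q := rat_num p v k.
have dv := cderX id_continuous k.+1 (cder_horner v x).
have vk0 := expf_neq0 k.+1 vx0.
have dqv := cderM id_continuous (cder_horner q x)
  (cderV (f := fun y => v.[y] ^+ k.+1) id_continuous vk0 dv).
apply: eq_cder (cder_eq _ dqv) => [//|].
rewrite /frat /= -/q hornerD hornerN hornerMn !hornerM !exprS.
have vek := expf_neq0 k vx0; move: (v.[x] ^+ k) vek => e e0.
by field; apply/andP.
Qed.

(** For q = (F 0 x - F 0 z) / (x - z) and m > 0, Leibniz gives F m x = (x - z) q^(m) + m q^(m-1);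
    writing q^(m) over (x - z) ^ (m + 1) turns this into the recursion for the numerators. *)
Fixpoint dquo_num (z : K) F m x : K :=
  if m is m'.+1 then (x - z) ^+ m * F m x - m%:R * dquo_num z F m' x
  else F 0 x - F 0 z.

(* The m-th derivative of x |-> (F 0 x - F 0 z) / (x - z), extended to z. *)
Definition dquo z F m x : K :=
  if x == z then F m.+1 z / m.+1%:R else dquo_num z F m x / (x - z) ^+ m.+1.

Lemma dquo_num_center z F m : dquo_num z F m z = 0.
Proof.
by elim: m => [|m IH] /=; rewrite ?IH subrr // expr0n mul0r mulr0 subr0.
Qed.

Lemma dquo_mulE z F x : F 0 x = F 0 z + (x - z) * dquo z F 0 x.
Proof.
rewrite /dquo; case: eqVneq => [->|xz]; first by rewrite subrr mul0r addr0.
by rewrite expr1 mulrC divfK ?subr_eq0 //= addrC subrK.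
Qed.

(** Leibniz's rule for (x - z) q. It is purely algebraic: away from [z] it is the recursion of
    [dquo_num], and at [z] it dictates the value given to [dquo]. *)
Lemma dquo_derivE z F m x :
  F m.+1 x = (x - z) * dquo z F m.+1 x + m.+1%:R * dquo z F m x.
Proof.
rewrite /dquo; case: eqVneq => [->|xz].
  by rewrite subrr mul0r add0r mulrC divfK // pnatr_eq0.
have xz0 : x - z != 0 by rewrite subr_eq0.
rewrite /= !exprS; have := expf_neq0 m xz0; move: ((x - z) ^+ m) => e e0.
by field; apply/andP.
Qed.

(** For m > 0 the derivative of the factor (x - z) ^ m cancels against m times the derivative of the
    previous numerator. *)
Lemma cder_dquo_num D z F m x : family D F -> D x ->
  cder id (dquo_num z F m) x ((x - z) ^+ m * F m.+1 x).
Proof.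
move=> dF Dx; elim: m => [|m IH] /=.
  rewrite expr0 mul1r; have := cderB id_continuous (dF 0 x Dx) (cder_cst _ x (F
    0 z)).
  by rewrite subr0.
have dxz : cder id (fun y : K => y - z) x 1.
  have := cderB id_continuous (cder_io id x) (cder_cst _ x z).
  by rewrite subr0.
have := cderB id_continuous (cderM id_continuous (cderX id_continuous m.+1 dxz)
  (dF m.+1 x Dx)) (cderZ id_continuous m.+1%:R IH).
apply: cder_eq; rewrite /= mul1r; ring.
Qed.

End families.

Arguments id_continuous {K}.

Section complex_families.
Variable R : realType.
Local Notation C := (CC R).
Implicit Types (D : set C) (F G : nat -> C -> C).

(** Derivatives at a point of an open set depend only on the values nearby, so [cderiven] is
    recovered from any family; this also makes families unique. *)
Lemma family_cderiven D F (f : C -> C) : open D -> family D F ->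
  (forall x, D x -> f x = F 0 x) -> forall k x, D x -> cderiven k f x = F k x.
Proof.
move=> oD dF fF; elim=> [|k IH] x Dx; first exact: fF.
have nD : \forall y \near x, D y by exact: open_nbhs_nbhs.
have dk : cder id (cderiven k f : C -> C) x (F k.+1 x).
  by apply: near_cder (dF k x Dx); apply: filterS nD => y /IH.
have -> : cderiven k.+1 f x = derive1 (cderiven k f : C -> C) x by [].
by rewrite derive1E; have [] := cder_is_derive dk.
Qed.

(** Away from [z] this is the quotient rule. At [z] the numerator, with derivative (w - z) ^ m F (m
    + 1) w, is compared with its two leading Taylor terms by the mean value inequality on a segment
    from [z]; the smallness comes from differentiability of [F m.+1] at [z]. *)
Lemma family_dquo D z F : open D -> family D F -> family D (dquo z F).
Proof.
move=> oD dF m x Dx; have [xz|xz] := eqVneq x z; last first.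
  have xz0 : x - z != 0 by rewrite subr_eq0.
  have dxz : cder id (fun y : C => y - z) x 1.
    have := cderB id_continuous (cder_io id x) (cder_cst _ x z).
    by rewrite subr0.
  have dq := cderM id_continuous (cder_dquo_num z m dF Dx)
    (cderV (f := fun y : C => (y - z) ^+ m.+1) id_continuous
      (expf_neq0 m.+1 xz0) (cderX id_continuous m.+1 dxz)).
  have dE : (x - z) ^+ m * F m.+1 x * ((x - z) ^+ m.+1)^-1 + dquo_num z F m x *
      (- (1 * (x - z) ^+ m.+1.-1 *+ m.+1) / ((x - z) ^+ m.+1) ^+ 2) =
      dquo z F m.+1 x.
    rewrite /dquo (negbTE xz) /= mul1r !exprS.
    have := expf_neq0 m xz0; move: ((x - z) ^+ m) => e e0.
    by field; apply/andP.
  have nz : \forall y \near x, y != z.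
    apply/nbhsC; exists (cabs (x - z)) => [|y]; first by rewrite cabs_gt0.
    by apply: contraTneq => ->; rewrite -cabsN opprB ltxx.
  apply: near_cder (cder_eq dE dq); near=> y.
  rewrite /dquo ifN //; by near: y.
rewrite -{z}xz.
apply/cder_eps => e e0.
have /cder_eps/(_ e e0) /nbhsC[r r0 rP] := dF m.+1 x Dx.
have /nbhsC[s s0 sD] : nbhs x D by exact: open_nbhs_nbhs.
apply/nbhsC; exists (Num.min r s); first by rewrite lt_min r0.
move=> y; rewrite lt_min => /andP[yr ys].
have [->|yx] := eqVneq y x; first by rewrite !subrr mulr0 subrr cabs0 mulr0.
have yx0 : y - x != 0 by rewrite subr_eq0.
(* a / (m + 1) is the value of the quotient at the centre and b / (m + 2) its expected derivative.
   [S] is the error of this affine approximation multiplied by (w - x) ^ (m + 1), which clears the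
   denominator. *)
pose a := F m.+1 x; pose b := F m.+2 x.
pose S (w : C) := dquo_num x F m w - a / m.+1%:R * (w - x) ^+ m.+1
  - b / m.+2%:R * (w - x) ^+ m.+2.
pose S' (w : C) := (w - x) ^+ m * (F m.+1 w - a - b * (w - x)).
pose ga t := x + RC t * (y - x).
have dga t : cder (@RC R) ga t (y - x).
  have := cderD (cder_cst _ t x) (cderM (@RtoC_continuous R) (cder_io (@RC R) t)
     (cder_cst _ t (y - x))).
  by rewrite mulr0 addr0 add0r mul1r.
have gax (t : R) : 0 <= t <= 1 -> cabs (ga t - x) <= cabs (y - x).
  move=> /andP[t0 t1]; rewrite /ga addrAC subrr add0r cabsM cabsR ger0_norm //.
  by rewrite ler_piMl // cabs_ge0.
have dS w : D w -> cder id S w (S' w).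
  move=> Dw.
  have dwx : cder id (fun y : C => y - x) w 1.
    have := cderB id_continuous (cder_io id w) (cder_cst _ w x).
    by rewrite subr0.
  have dS := cderB id_continuous (cderB id_continuous (cder_dquo_num x m dF Dw)
    (cderZ id_continuous (a / m.+1%:R) (cderX id_continuous m.+1 dwx)))
    (cderZ id_continuous (b / m.+2%:R) (cderX id_continuous m.+2 dwx)).
  apply: (@cder_eq _ _ _ S _ _ _ _ dS).
  have natK (c q : C) k : c / k.+1%:R * (q *+ k.+1) = c * q.
    by rewrite -[q *+ _]mulr_natl mulrA divfK // pnatr_eq0.
  rewrite /S' /= !mul1r !natK exprS -/a; ring.
have Sy : cabs (S y) <= e * cabs (y - x) ^+ m.+2.
  pose k := e * cabs (y - x) ^+ m.+2.
  have -> : S y = S (ga 1) - S (ga 0).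
    rewrite /ga /RC rmorph1 mul1r rmorph0 mul0r addr0 [x + _]addrC subrK.
    by rewrite {3}/S dquo_num_center subrr !expr0n !mulr0 !subr0.
  suff : cabs (S (ga 1) - S (ga 0)) <= k * 1 - k * 0.
    by rewrite mulr1 mulr0 subr0.
  apply: (@mean_value R (fun t => S (ga t)) (fun t => S' (ga t) * (y - x))
    (fun t => k * t) (fun=> k)).
  - move=> t t01; apply: (cder_comp (@RtoC_continuous R) (dga t)).
    by apply/dS/sD; rewrite (le_lt_trans (gax t t01)).
  - move=> t t01; have := is_deriveZ k (is_derive_id t (1 : R)).
    by rewrite [k *: _]mulr1.
  - move=> t t01; rewrite /S' !cabsM cabsX /k.
    rewrite [_ ^+ m.+2]exprSr mulrA ler_wpM2r ?cabs_ge0 //.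
    rewrite exprSr mulrCA [leLHS]mulrC [leLHS]mulrC.
    apply: ler_pM; rewrite ?exprn_ge0 ?cabs_ge0 //.
      by rewrite lerXn2r ?nnegrE ?cabs_ge0 // gax.
    apply: (le_trans (rP _ _)); first by rewrite (le_lt_trans (gax t t01)).
    by rewrite ler_wpM2l ?gax // ltW.
rewrite /dquo eqxx (negbTE yx) -/a -/b.
have -> : dquo_num x F m y / (y - x) ^+ m.+1 - a / m.+1%:R
   - b / m.+2%:R * (y - x) = S y / (y - x) ^+ m.+1.
  rewrite /S !mulrBl !mulfK ?expf_neq0 //; congr (_ - _).
  by rewrite [_ ^+ m.+2]exprS mulrA mulfK // expf_neq0.
rewrite cabsM cabsV cabsX ler_pdivrMr ?exprn_gt0 ?cabs_gt0 //.
by rewrite -mulrA -exprS.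
Unshelve. all: by end_near. Qed.

End complex_families.

(** * Power series *)

Section power_series.
Variable R : realType.
Local Notation C := (CC R).
Implicit Types (a : nat -> C) (D : set C) (f : C -> C).

Lemma sum_half_le n : \sum_(0 <= k < n) (2^-1 : R) ^+ k <= 2.
Proof.
suff -> : \sum_(0 <= k < n) (2^-1 : R) ^+ k = 2 - 2 * 2^-1 ^+ n.
  by rewrite gerBl mulr_ge0 // exprn_ge0 // invr_ge0.
elim: n => [|n IH]; first by rewrite big_geq // expr0; ring.
by rewrite big_nat_recr //= IH exprS; field.
Qed.

Lemma is_cvg_series_half (c : nat -> C) (M : R) :
  (forall k, cabs (c k) <= M * 2^-1 ^+ k) ->
  exists l : C, series c @ \oo --> l.
Proof.
move=> cM.
have cvg_half (u : nat -> R) : (forall k, `|u k| <= M * 2^-1 ^+ k) ->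
    cvgn (series u).
  move=> uM; apply: normed_cvg.
  apply: (series_le_cvg (v_ := geometric M 2^-1)) => [n|n|n|] //=.
    exact: le_trans (uM n).
  apply: is_cvg_geometric_series.
  by rewrite ger0_norm ?invr_ge0 // invf_lt1 // ltr1n.
have cR := cvg_half (fun k => complex.Re (c k)) (fun k => le_trans (Re_le_cabs
  _) (cM k)).
have cI := cvg_half (fun k => complex.Im (c k)) (fun k => le_trans (Im_le_cabs
  _) (cM k)).
have ReE : (fun n => complex.Re (series c n)) = series (fun k => complex.Re (c k)).
  by apply/funext => n; rewrite /series /= raddf_sum.
have ImE : (fun n => complex.Im (series c n)) = series (fun k => complex.Im (c k)).
  by apply/funext => n; rewrite /series /= raddf_sum.
exists (limn (series (fun k => complex.Re (c k))) +i*
        limn (series (fun k => complex.Im (c k)))).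
by apply: cvgC_ReIm; rewrite /= ?ReE ?ImE.
Qed.

Lemma cvg_coef_bound a (z l : C) :
  [series a k * z ^+ k]_k @ \oo --> l -> exists M : R, forall k,
  cabs (a k) * cabs z ^+ k <= M.
Proof.
move=> al.
have /cvg_seq_bounded : cvgn (fun k => a k * z ^+ k).
  apply/cvg_ex; exists 0; apply: cvg_series_cvg_0.
  by apply/cvg_ex; exists l.
move=> /pinfty_ex_gt0[M _ akM].
exists (complex.Re M) => k.
have : `|a k * z ^+ k| <= M by exact: akM.
rewrite normCE lecE /= => /andP[_].
by rewrite cabsM cabsX.
Qed.

Definition taylor1_rest k (x y : C) := y ^+ k.+1 - x ^+ k.+1 - k.+1%:R * x ^+ k
  * (y - x).

(* The factor s ^+ 2 stands for the exponent k - 1 of s on the right, which is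
   negative for k = 0. *)
Lemma taylor1_rest_le (s : R) k (x y : C) : cabs x <= s -> cabs y <= s ->
  s ^+ 2 * cabs (taylor1_rest k x y) <= 4 ^+ k.+1 * s ^+ k.+1 * cabs (y - x) ^+ 2.
Proof.
move=> xs ys; have s0 : 0 <= s := le_trans (cabs_ge0 x) xs.
pose d := cabs (y - x) ^+ 2; have d0 : 0 <= d by rewrite exprn_ge0 ?cabs_ge0.
(* The induction runs with the sharper factor (k + 1) ^ 2, which is at most (2 ^ (k + 1)) ^ 2 = 4 ^
   (k + 1). *)
suff : s ^+ 2 * cabs (taylor1_rest k x y) <= k.+1%:R ^+ 2 * s ^+ k.+1 * d.
  move=> /le_trans; apply; rewrite ler_wpM2r // ler_wpM2r ?exprn_ge0 //.
  rewrite -natrX -natrX ler_nat -[4%N]/(2 ^ 2)%N -expnM mulnC expnM.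
  by rewrite leq_exp2r // ltnW // ltn_expl.
elim: k => [|k IH].
  rewrite /taylor1_rest !expr1 expr0 !mulr1 mul1r subrr cabs0 mulr0.
  by rewrite mulr_ge0 // mulr_ge0.
(* Multiplying by y raises the degree at the price of one quadratic term; the step closes because (k
   + 1) ^ 2 + (k + 1) <= (k + 2) ^ 2. *)
have -> : taylor1_rest k.+1 x y =
    y * taylor1_rest k x y + k.+1%:R * x ^+ k * (y - x) ^+ 2.
  by rewrite /taylor1_rest !exprS -[k.+2%:R]natr1; ring.
apply: le_trans (ler_wpM2l (exprn_ge0 2 s0) (ler_cabsD _ _)) _.
rewrite mulrDr; apply: (@le_trans _ _
    (s * (k.+1%:R ^+ 2 * s ^+ k.+1 * d) + k.+1%:R * s ^+ k.+2 * d)).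
  apply: lerD.
    rewrite cabsM mulrCA; apply: ler_pM => //; rewrite ?cabs_ge0 //.
    by rewrite mulr_ge0 ?exprn_ge0 ?cabs_ge0.
  rewrite !cabsM !cabsX cabs_nat -[cabs (y - x) * _]expr2 -/d.
  rewrite mulrA; apply: ler_wpM2r => //.
  rewrite mulrCA; apply: ler_wpM2l => //.
  rewrite -[k.+2]addn2 addnC exprD ler_wpM2l ?exprn_ge0 //.
  by apply: lerXn2r; rewrite ?nnegrE ?cabs_ge0.
rewrite [leLHS](_ : _ = (k.+1%:R ^+ 2 + k.+1%:R) * (s ^+ k.+2 * d)); last first.
  by rewrite [s ^+ k.+2]exprS; ring.
rewrite -[leRHS]mulrA ler_wpM2r //; first by rewrite mulr_ge0 // exprn_ge0.
rewrite -[k.+2%:R]natr1; set m : R := k.+1%:R.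
have : 0 <= m by []. 
nra.
Qed.

Definition pderiv a k : C := k.+1%:R * a k.+1.

(** On a smaller disc the error of the linear approximation is at most a constant times cabs (y - x)
    ^ 2, uniformly over the partial sums, and such a quadratic bound yields the derivative.
    Shrinking the disc is harmless, as analyticity is a local condition. *)
Lemma termwise_derivation a (f : C -> C) (r : R) : 0 < r ->
  (forall x, cabs x < r -> [series a k * x ^+ k]_k @ \oo --> f x) ->
  exists2 s : R, 0 < s & forall x, cabs x < s -> exists2 d,
    cder id f x d & [series pderiv a k * x ^+ k]_k @ \oo --> d.
Proof.
move=> r0 af; pose th := r / 2.
have th0 : 0 < th by rewrite divr_gt0.
have thr : cabs th%:C < r.
  by rewrite cabsR gtr0_norm // ltr_pdivrMr // ltr_pMr // ltr1n.
have [M aM] := cvg_coef_bound (af _ thr).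
rewrite cabsR gtr0_norm // in aM.
(* k ^ 2 <= 4 ^ k, so that on this radius the derived series and the Taylor
   rests are dominated by a geometric series of ratio 1/2. *)
pose s := th / 8; have s0 : 0 < s by rewrite divr_gt0.
have aks k : cabs (a k) * (4 ^+ k * s ^+ k) <= M * 2^-1 ^+ k.
  rewrite -exprMn (_ : 4 * s = th * 2^-1); last by rewrite /s; field.
  by rewrite exprMn mulrA ler_wpM2r // exprn_ge0 // invr_ge0.
have sr : s < r.
  by rewrite /s /th; lra.
exists s => // x xs.
pose g k := pderiv a k * x ^+ k.
have gM k : cabs (g k) <= M / s * 2^-1 ^+ k.
  rewrite mulrAC ler_pdivlMr //; apply: (le_trans _ (le_trans (aks k.+1) _)).
    have -> : cabs (g k) * s = cabs (a k.+1) * (k.+1%:R * (cabs x ^+ k * s)).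
      by rewrite /g /pderiv !cabsM cabsX cabs_nat; ring.
    rewrite ler_wpM2l ?cabs_ge0 // [s ^+ k.+1]exprSr.
    apply: ler_pM => //; first by rewrite mulr_ge0 ?exprn_ge0 ?cabs_ge0 // ltW.
      by rewrite -natrX ler_nat ltnW // ltn_expl.
    rewrite ler_wpM2r ?(ltW s0) //.
    by apply: lerXn2r; rewrite ?nnegrE ?cabs_ge0 ?(ltW s0) ?(ltW xs).
  have M0 : 0 <= M.
    by apply: le_trans (aM 0); rewrite expr0 mulr1 cabs_ge0.
  rewrite exprS mulrCA ler_piMl ?mulr_ge0 ?exprn_ge0 ?invr_ge0 //.
  by rewrite invf_le1 // ler1n.
have [d gd] := is_cvg_series_half gM.
exists d => //.
have fK y : cabs y < s ->
    cabs (f y - f x - d * (y - x)) <= M * 2 / s ^+ 2 * cabs (y - x) ^+ 2.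
  move=> ys.
  (* The series of [f] gets one more term than the derived series, which has lost the constant term;
     the constant terms at [y] and [x] cancel. *)
  pose u n := series (fun k => a k * y ^+ k) n.+1 - series (fun k => a k * x ^+
    k) n.+1 -
    series g n * (y - x).
  have uE n : u n = \sum_(0 <= k < n) a k.+1 * taylor1_rest k x y.
    rewrite /u /series /= !big_nat_recl //= !expr0 opprD addrACA subrr add0r.
    rewrite mulr_suml -!sumrB; apply: eq_bigr => k _.
    rewrite /g /pderiv /taylor1_rest; ring.
  have uM n : cabs (u n) <= M * 2 / s ^+ 2 * cabs (y - x) ^+ 2.
    rewrite uE mulrAC ler_pdivlMr ?exprn_gt0 //.
    rewrite (le_trans (ler_wpM2r _ (ler_cabs_sum _ _))) ?exprn_ge0 ?(ltW s0) //.
    have M0 : 0 <= M.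
      by apply: le_trans (aM 0); rewrite expr0 mulr1 cabs_ge0.
    rewrite mulr_suml (@le_trans _ _ (\sum_(0 <= k < n)
        M * cabs (y - x) ^+ 2 * 2^-1 ^+ k)) //.
      apply: ler_sum => k _.
      have -> : cabs (a k.+1 * taylor1_rest k x y) * s ^+ 2 =
          cabs (a k.+1) * (s ^+ 2 * cabs (taylor1_rest k x y)).
        by rewrite cabsM; ring.
      apply: (le_trans (ler_wpM2l (cabs_ge0 _) (taylor1_rest_le k (ltW xs) (ltW
        ys)))).
      rewrite mulrA [leRHS]mulrAC ler_wpM2r ?exprn_ge0 ?cabs_ge0 //.
      apply: (le_trans (aks _)).
      rewrite exprS mulrCA ler_piMl ?mulr_ge0 ?exprn_ge0 ?invr_ge0 //.
      by rewrite invf_le1 // ler1n.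
    rewrite -mulr_sumr [leRHS]mulrAC ler_wpM2l ?sum_half_le //.
    by rewrite mulr_ge0 // exprn_ge0 ?cabs_ge0.
  have cu : u @ \oo --> f y - f x - d * (y - x).
    have shift_cvg w : cabs w < s ->
        series (fun k => a k * w ^+ k) n.+1 @[n --> \oo] --> f w.
      by move=> ws; rewrite (cvg_shiftS (series (fun k => a k * w ^+ k)));
        apply: af; exact: lt_trans sr.
    apply: cvgB; first by apply: cvgB; exact: shift_cvg.
    by apply: cvgM; [exact: gd|exact: cvg_cst].
  have cau : cabs (u n) @[n --> \oo] --> cabs (f y - f x - d * (y - x)).
    exact: (cvg_comp _ _ cu (@cabs_continuous R _)).
  by apply: (cvgr_to_le cau); near=> n; exact: uM.
apply/cder_eps => e e0.
pose K := M * 2 / s ^+ 2.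
(* The first radius keeps [y] in the disc of radius s, the second makes K cabs (y - x) at most e;
   the summand 1 avoids division by zero. *)
apply/nbhsC; exists (Num.min (s - cabs x) (e / (`|K| + 1))).
  by rewrite lt_min subr_gt0 xs divr_gt0 // ltr_wpDl.
move=> y; rewrite lt_min => /andP[ys ye].
have ys' : cabs y < s.
  rewrite -(subrK x y) (le_lt_trans (ler_cabsD _ _))//; lra.
apply: (le_trans (fK y ys')); rewrite -/K expr2 mulrA ler_wpM2r ?cabs_ge0 //.
move: ye; rewrite ltr_pdivlMr ?ltr_wpDl // => ye.
apply: le_trans (ltW ye); rewrite mulrC ler_wpM2l ?cabs_ge0 //.
by rewrite (le_trans (ler_norm K))// lerDl.
Unshelve. all: by end_near. Qed.

(** The expansion at a point gives the derivative throughout a disc, as the sum of the derived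
    series; so the derivative is again analytic and the argument can be iterated. *)
Lemma analytic_derivative D f : open D -> analytic_on D f ->
  (forall x, D x -> cder id f x (cderiven 1 f x)) /\ analytic_on D (cderiven 1 f).
Proof.
move=> oD fan.
have derE x d : cder id f x d -> cderiven 1 f x = d.
  by move=> /cder_is_derive df; rewrite /cderiven derive1n1 derive1E; case: df.
have H z0 : D z0 -> exists (s : R) a, 0 < s /\ forall x, cabs (x - z0) < s ->
    cder id f x (cderiven 1 f x) /\
    [series pderiv a k * (x - z0) ^+ k]_k @ \oo --> (cderiven 1 f x : C).
  move=> Dz0; have [a /nbhsC[r r0 ar]] := fan z0 Dz0.
  have [|s s0 sd] := @termwise_derivation a (fun x => f (x + z0)) r r0.
    by move=> x xr; have := ar (x + z0); rewrite addrK; apply.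
  exists s, a; split=> // x xs.
  have [d df dx] := sd _ xs.
  have dfx : cder id f x d.
    have dxz : cder id (fun y : C => y - z0) x 1.
      have := cderB id_continuous (cder_io id x) (cder_cst _ x z0).
      by rewrite subr0.
    have := cder_comp id_continuous dxz df; rewrite mulr1.
    by apply: eq_cder => y; rewrite subrK.
  by rewrite (derE _ _ dfx).
split=> [x Dx|z0 Dz0].
  have [s [a [s0 /(_ x)]]] := H x Dx.
  by rewrite subrr cabs0 => /(_ s0)[].
have [s [a [s0 sa]]] := H z0 Dz0.
exists (pderiv a); apply/nbhsC; exists s => // y /sa[_].
exact.
Qed.

Lemma analytic_family D f : open D -> analytic_on D f ->
  family D (fun k => cderiven k f).
Proof.
have cdS k : cderiven k.+1 f = cderiven 1 (cderiven k f) by [].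
move=> oD fan k x Dx.
have kan : analytic_on D (cderiven k f).
  elim: k => [|k IH]; first exact: fan.
  by rewrite cdS; have [_] := analytic_derivative oD IH.
by rewrite cdS; have [+ _] := analytic_derivative oD kan; apply.
Qed.

End power_series.

(** * Contour integrals *)

Section real_integral.
Variable R : realType.
Local Notation mu := (@lebesgue_measure R).

Definition continuous_on_segment (V : topologicalType) (b : R) (f : R -> V) :=
  forall t : R, 0 <= t <= b -> {for t, continuous f}.

Lemma segment_within (f : R -> R) b :
  continuous_on_segment b f -> {within `[0, b], continuous f}.
Proof.
move=> cf; apply: continuous_in_subspaceT => t.
by rewrite inE /= in_itv /=; exact: cf.
Qed.

Lemma segment_integrable (f : R -> R) b :
  continuous_on_segment b f -> mu.-integrable `[0, b] (EFin \o f).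
Proof.
move=> /segment_within; apply: continuous_compact_integrable.
exact: segment_compact.
Qed.

Lemma Rintegral_FTC (f F : R -> R) b : 0 < b -> continuous_on_segment b f ->
  (forall t : R, 0 <= t <= b -> is_derive t (1 : R) F (f t)) ->
  \int[mu]_(t in `[0, b]) f t = F b - F 0.
Proof.
move=> b0 cf dF.
have cF t : 0 <= t <= b -> F x @[x --> t] --> F t.
  move=> tb; apply: differentiable_continuous; apply/derivable1_diffP.
  by have [] := dF t tb.
rewrite /Rintegral (@continuous_FTC2 _ _ F) //=.
- exact: segment_within.
- split.
  + move=> t /[!in_itv] /= /andP[/ltW t0 /ltW tb].
    by have [] := dF t _; rewrite ?t0.
  + by apply: cvg_at_right_filter; apply: cF; rewrite lexx ltW.
  + by apply: cvg_at_left_filter; apply: cF; rewrite lexx ltW.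
- move=> t /[!in_itv] /= /andP[/ltW t0 /ltW tb].
  by rewrite derive1E; have [] := dF t _; rewrite ?t0.
Qed.

Lemma derive0_eq (F : R -> R) :
  (forall s : R, 0 <= s <= 1 -> is_derive s (1 : R) F 0) -> F 1 = F 0.
Proof.
move=> dF.
have [|||c _] := @MVT_segment R F (fun=> 0) 0 1.
- by [].
- by move=> s /[!in_itv] /= /andP[/ltW s0 /ltW s1]; apply: dF; rewrite s0.
- apply: derivable_within_continuous => s /[!in_itv] /= sI.
  by have [] := dF s sI.
by rewrite mul0r => /eqP; rewrite subr_eq0 => /eqP.
Qed.

(* The derivative of s |-> \int k s is \int k1 s = m s b - m s 0 = 0. *)
Lemma Rintegral_homotopy (k k1 m : R -> R -> R) (u v b : R) :
  u < 0 -> 1 < v -> 0 < b ->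
  (forall s t : R, u <= s <= v -> 0 <= t <= b ->
    [/\ is_derive s (1 : R) (k^~ t) (k1 s t), is_derive t (1 : R) (m s) (k1 s t),
        {for t, continuous (k s)} &
        {for (s, t), continuous (fun p : R * R => k1 p.1 p.2)}]) ->
  (forall s, m s 0 = m s b) ->
  \int[mu]_(t in `[0, b]) k 1 t = \int[mu]_(t in `[0, b]) k 0 t.
Proof.
move=> u0 v1 b0 H mper.
have ck1 s : u <= s <= v -> continuous_on_segment b (k1 s).
  move=> sI t tI; have [_ _ _ c1] := H s t sI tI.
  exact: (cvg_comp2 (F := nbhs t) (G := nbhs s) (H := nbhs t) (f := fun=> s)
    (g := id) (h := k1) (cvg_cst s) cvg_id c1).
(* Compactness of the rectangle provides the constant that dominates the partial derivative under
   the integral sign. *)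
have [M kM] : exists M : R, forall s t : R, u <= s <= v -> 0 <= t <= b -> `|k1 s
  t| <= M.
  have : compact (`[u, v] `*` `[0, b] : set (R * R)).
    by apply: compact_setX; exact: segment_compact.
  move=> /(@compact_EVT_max _ _ (fun p : R * R => `|k1 p.1 p.2|))[||p _ pM].
  - exists (0, 0); split; rewrite /= in_itv /= ?lexx ?(ltW u0) ?(ltW b0) //=.
    exact: ltW (lt_trans ltr01 v1).
  - apply: continuous_in_subspaceT => -[s t].
    rewrite inE /= => -[]; rewrite !in_itv /= => sI tI.
    have [_ _ _ c1] := H s t sI tI.
    exact: (cvg_norm c1).
  - exists `|k1 p.1 p.2| => s t sI tI; apply: (pM (s, t)).
    by rewrite inE; split; rewrite /= in_itv.
have M0 : 0 <= M.
  apply: le_trans (kM 0 0 _ _); rewrite ?normr_ge0 ?lexx ?(ltW u0) ?(ltW b0) //=.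
  exact: ltW (lt_trans ltr01 v1).
pose F s := \int[mu]_(t in `[0, b]) k s t.
have itvW (s : R) : `]u, v[%classic s -> u <= s <= v.
  by rewrite /= in_itv /= => /andP[/ltW -> /ltW ->].
have intk (s : R) : `]u, v[%classic s -> mu.-integrable `[0, b] (EFin \o k s).
  move=> /itvW sI; apply: segment_integrable => t tI.
  by have [_ _ ] := H s t sI tI.
have derk (s t : R) : `]u, v[%classic s -> `[0, b]%classic t -> derivable (k^~
  t) s 1.
  move=> /itvW sI; rewrite /= in_itv /= => tI.
  by have [[]] := H s t sI tI.
have d1E (s t : R) : `]u, v[%classic s -> `[0, b]%classic t -> partial1of2 k s t
  = k1 s t.
  move=> /itvW sI; rewrite /= in_itv /= => tI.
  by rewrite partial1of2E; have [[_]] := H s t sI tI.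
have intG : mu.-integrable `[0, b] (EFin \o (fun _ : R => M)).
  by apply: segment_integrable => t tI; exact: cvg_cst.
have ubG (s t : R) : `]u, v[%classic s -> `[0, b]%classic t -> `|partial1of2 k s
  t| <= M.
  move=> sI tI; rewrite d1E //; apply: kM; first exact: itvW.
  by move: tI; rewrite /= in_itv.
have dF (s : R) : `]u, v[%classic s -> is_derive s (1 : R) F 0.
  move=> sI; have mI : measurable (`[0, b]%classic : set (measurableTypeR R)).
    exact: measurable_itv.
  have dFs : derivable F s 1 := derivable_under_integral (mu := mu) mI sI intk
    derk (fun=> M0) intG ubG.
  apply: DeriveDef => //; rewrite -derive1E.
  rewrite (differentiation_under_integral (mu := mu) mI sI intk derk (fun=> M0)
    intG ubG).
  transitivity (\int[mu]_(y in `[0, b]) k1 s y).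
    by apply: eq_Rintegral => t; rewrite inE => tI; exact: d1E.
  have FTC : \int[mu]_(y in `[0, b]) k1 s y = m s b - m s 0.
    apply: Rintegral_FTC b0 _ _; first by apply: ck1; exact: itvW.
    by move=> t tI; have [] := H s t (itvW _ sI) tI.
  by rewrite FTC mper subrr.
have I01 (s : R) : 0 <= s <= 1 -> `]u, v[%classic s.
  move=> /andP[s0 s1]; rewrite /= in_itv /=.
  by rewrite (lt_le_trans u0 s0) (le_lt_trans s1 v1).
by apply: (derive0_eq (F := F)) => s /I01; exact: dF.
Qed.

End real_integral.

Section complex_integral.
Variable R : realType.
Local Notation C := (CC R).
Local Notation mu := (@lebesgue_measure R).
Local Notation Re := (@complex.Re R).
Local Notation Im := (@complex.Im R).

Lemma continuous_Re b (f : R -> C) : continuous_on_segment b f ->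
  continuous_on_segment b (fun t => Re (f t)).
Proof. by move=> cf t /cf ct; apply: (cvg_comp _ _ ct); exact: Re_continuous. Qed.

Lemma continuous_Im b (f : R -> C) : continuous_on_segment b f ->
  continuous_on_segment b (fun t => Im (f t)).
Proof. by move=> cf t /cf ct; apply: (cvg_comp _ _ ct); exact: Im_continuous. Qed.

Lemma cintegralD b (f g : R -> C) :
  continuous_on_segment b f -> continuous_on_segment b g ->
  cintegral 0 b (fun t => f t + g t) = cintegral 0 b f + cintegral 0 b g.
Proof.
move=> cf cg; rewrite /cintegral.
have -> : (fun t => complex.Re (f t + g t)) = (fun t => Re (f t) + Re (g t)).
  by apply/funext => t; rewrite raddfD.
have -> : (fun t => complex.Im (f t + g t)) = (fun t => Im (f t) + Im (g t)).
  by apply/funext => t; rewrite raddfD.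
rewrite !RintegralD //; try (apply: segment_integrable);
  by [exact: continuous_Re|exact: continuous_Im|].
Qed.

Lemma cintegralZ b (a : C) (f : R -> C) : continuous_on_segment b f ->
  cintegral 0 b (fun t => a * f t) = a * cintegral 0 b f.
Proof.
move=> cf; rewrite /cintegral; case: a => x y.
have iR := segment_integrable (continuous_Re cf).
have iI := segment_integrable (continuous_Im cf).
have iZ c (h : R -> R) : mu.-integrable `[0, b] (EFin \o h) ->
    mu.-integrable `[0, b] (EFin \o (fun t => c * h t)).
  move=> ih; rewrite [X in integrable _ _ X](_ : _ = (fun t => c%:E * (h
    t)%:E)%E) //.
  exact: integrableZl.
have -> : (fun t => complex.Re ((x +i* y) * f t)) = (fun t => x * Re (f t) - y *
  Im (f t)).
  by apply/funext => t; case: (f t).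
have -> : (fun t => complex.Im ((x +i* y) * f t)) = (fun t => x * Im (f t) + y *
  Re (f t)).
  by apply/funext => t; case: (f t) => p q /=; rewrite addrC.
rewrite RintegralB //; [|exact: iZ|exact: iZ].
rewrite RintegralD //; [|exact: iZ|exact: iZ].
by rewrite !RintegralZl // [in RHS]addrC.
Qed.

Lemma cintegral_FTC b (f F : R -> C) : 0 < b -> continuous_on_segment b f ->
  (forall t : R, 0 <= t <= b -> cder (@RC R) F t (f t)) ->
  cintegral 0 b f = F b - F 0.
Proof.
move=> b0 cf dF; rewrite /cintegral.
have -> : \int[mu]_(t in `[0, b]) Re (f t) = Re (F b) - Re (F 0).
  apply: (Rintegral_FTC (F := fun t => Re (F t)) b0); first exact: continuous_Re.
  by move=> t tI; exact/cder_Re/dF.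
have -> : \int[mu]_(t in `[0, b]) Im (f t) = Im (F b) - Im (F 0).
  apply: (Rintegral_FTC (F := fun t => Im (F t)) b0); first exact: continuous_Im.
  by move=> t tI; exact/cder_Im/dF.
by case: (F b) (F 0) => [x y] [x' y'].
Qed.

(** For loops w s t and a function h, [k] is to be h(w) times the t-derivative of w, and [m] is h(w)
    times its s-derivative; [k1] is then the common value of the s-derivative of [k] and the
    t-derivative of [m]. *)
Lemma cintegral_homotopy (k k1 m : R -> R -> C) (u v b : R) :
  u < 0 -> 1 < v -> 0 < b ->
  (forall s t : R, u <= s <= v -> 0 <= t <= b ->
    [/\ cder (@RC R) (k^~ t) s (k1 s t), cder (@RC R) (m s) t (k1 s t),
        {for t, continuous (k s)} &
        {for (s, t), continuous (fun p : R * R => k1 p.1 p.2)}]) ->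
  (forall s, m s 0 = m s b) ->
  cintegral 0 b (k 1) = cintegral 0 b (k 0).
Proof.
move=> u0 v1 b0 H mper; rewrite /cintegral.
rewrite (@Rintegral_homotopy R (fun s t => Re (k s t)) (fun s t => Re (k1 s t))
  (fun s t => Re (m s t)) u v) //; last 2 first.
- move=> s t sI tI; have [dk dm ck ck1] := H s t sI tI; split.
  + exact: cder_Re dk.
  + exact: cder_Re dm.
  + by apply: (cvg_comp _ _ ck); exact: Re_continuous.
  + by apply: (cvg_comp _ _ ck1); exact: Re_continuous.
- by move=> s; rewrite mper.
rewrite (@Rintegral_homotopy R (fun s t => Im (k s t)) (fun s t => Im (k1 s t))
  (fun s t => Im (m s t)) u v) //; last 2 first.
- move=> s t sI tI; have [dk dm ck ck1] := H s t sI tI; split.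
  + exact: cder_Im dk.
  + exact: cder_Im dm.
  + by apply: (cvg_comp _ _ ck); exact: Im_continuous.
  + by apply: (cvg_comp _ _ ck1); exact: Im_continuous.
- by move=> s; rewrite mper.
Qed.

End complex_integral.

(** * Circles: Cauchy's theorem and the integral around a simple pole *)

Section circle.
Variable R : realType.
Local Notation C := (CC R).
Local Notation RC := (@RC R).
Implicit Types (c a x w : C) (r s t : R) (h H : C -> C).

Definition cis t : C := cos t +i* sin t.
Definition dcis t : C := - sin t +i* cos t.
Definition circle c r t : C := c + r%:C * cis t.

Lemma circle_integralE c r h : circle_integral c r h =
  cintegral 0 (pi *+ 2) (fun t => h (circle c r t) * (RC r * dcis t)).
Proof. by []. Qed.

Lemma dcisE t : dcis t = 'i * cis t.
Proof. by rewrite /dcis /cis; apply/eqP; rewrite eq_complex /= !mul0r !mul1r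
  sub0r add0r !eqxx. Qed.

Lemma cabs_cis t : cabs (cis t) = 1.
Proof.
by rewrite /cabs [`|_|]normc_def /= cos2Dsin2 sqrtr1.
Qed.

Lemma cis_neq0 t : cis t != 0.
Proof. by rewrite -cabs_eq0 cabs_cis oner_eq0. Qed.

Lemma cis_period : cis (pi *+ 2) = cis 0.
Proof. by rewrite /cis cos2pi sin2pi cos0 sin0. Qed.

Lemma cder_cis t : cder RC cis t (dcis t).
Proof.
exact: cder_ReIm.
Qed.

Lemma cder_dcis t : cder RC dcis t (- cis t).
Proof.
have := cderZ (@RtoC_continuous R) ('i : C) (cder_cis t).
rewrite dcisE mulrA; have -> : ('i : C) * 'i = -1 by rewrite -expr2 sqr_i.
by rewrite mulN1r; apply: eq_cder => s; rewrite dcisE.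
Qed.

Lemma cis_continuous : continuous cis.
Proof. by move=> t; exact: cder_continuous (@RtoC_continuous R t) (cder_cis t). Qed.

Lemma dcis_continuous : continuous dcis.
Proof. by move=> t; exact: cder_continuous (@RtoC_continuous R t) (cder_dcis t). Qed.

Lemma cder_circle c r t : cder RC (circle c r) t (RC r * dcis t).
Proof.
have := cderD (cder_cst RC t c) (cderZ (@RtoC_continuous R) (RC r) (cder_cis t)).
by rewrite add0r.
Qed.

Lemma circle_continuous c r : continuous (circle c r).
Proof.
by move=> t; exact: cder_continuous (@RtoC_continuous R t) (cder_circle c r t).
Qed.

Lemma circle_period c r : circle c r (pi *+ 2) = circle c r 0.
Proof. by rewrite /circle cis_period. Qed.

Lemma cabs_circle c r t : 0 <= r -> cabs (circle c r t - c) = r.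
Proof.
move=> r0; rewrite /circle addrC addKr cabsM cabs_cis mulr1 cabsR ger0_norm //.
Qed.

Definition circle_continuous_at c r h :=
  forall w, cabs (w - c) = r -> {for w, continuous h}.

Lemma circle_integrand_continuous c r h b : 0 <= r -> circle_continuous_at c r h ->
  continuous_on_segment b (fun t => h (circle c r t) * (RC r * dcis t)).
Proof.
move=> r0 ch t _; apply: cvgM.
  apply: (cvg_comp _ _ (@circle_continuous c r t)); apply: ch.
  exact: cabs_circle.
by apply: cvgM; [exact: cvg_cst|exact: dcis_continuous].
Qed.

Lemma eq_circle_integral c r h H : 0 <= r ->
  (forall w, cabs (w - c) = r -> h w = H w) ->
  circle_integral c r h = circle_integral c r H.
Proof.
move=> r0 hH; rewrite !circle_integralE; congr cintegral.
by apply/funext => t; rewrite hH // cabs_circle.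
Qed.

Lemma circle_integralD c r h H : 0 <= r ->
  circle_continuous_at c r h -> circle_continuous_at c r H ->
  circle_integral c r (fun w => h w + H w) =
  circle_integral c r h + circle_integral c r H.
Proof.
move=> r0 ch cH; rewrite !circle_integralE -cintegralD.
- by congr cintegral; apply/funext => t; rewrite mulrDl.
- exact: circle_integrand_continuous.
- exact: circle_integrand_continuous.
Qed.

Lemma circle_integralZ c r a h : 0 <= r -> circle_continuous_at c r h ->
  circle_integral c r (fun w => a * h w) = a * circle_integral c r h.
Proof.
move=> r0 ch; rewrite !circle_integralE -cintegralZ.
  by congr cintegral; apply/funext => t; rewrite -mulrA.
exact: circle_integrand_continuous.
Qed.

Lemma pi2_gt0 : 0 < pi *+ 2 :> R.
Proof. by rewrite pmulrn_rgt0 // pi_gt0. Qed.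

Lemma circle_integral_primitive c r h H : 0 <= r -> circle_continuous_at c r h ->
  (forall w, cabs (w - c) = r -> cder id H w (h w)) -> circle_integral c r h = 0.
Proof.
move=> r0 ch dH; rewrite circle_integralE.
rewrite (@cintegral_FTC _ _ _ (fun t => H (circle c r t)) pi2_gt0).
- by rewrite circle_period subrr.
- exact: circle_integrand_continuous.
- move=> t _; apply: (cder_comp (@RtoC_continuous R) (cder_circle c r t)).
  by apply: dH; exact: cabs_circle.
Qed.

(** Continuity of the derivative is included because circles are contracted by differentiating under
    the integral sign. *)
Definition C1_on (D : set C) h := exists h', forall x, D x ->
  cder id h x (h' x) /\ {for x, continuous h'}.

Lemma C1_on_continuous D h x : C1_on D h -> D x -> {for x, continuous h}.
Proof.
by move=> [h' dh] Dx; apply: cder_continuous (dh x Dx).1; exact: id_continuous.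
Qed.

Lemma family_C1 D F : family D F -> C1_on D (F 0).
Proof.
move=> dF; exists (F 1) => x Dx; split; first exact: dF.
exact: cder_continuous (id_continuous _) (dF 1 x Dx).
Qed.

Lemma C1_onM D h H : C1_on D h -> C1_on D H -> C1_on D (fun x => h x * H x).
Proof.
move=> Ch CH; have [h' dh] := Ch; have [H' dH] := CH.
exists (fun x => h' x * H x + h x * H' x) => x Dx.
have [dhx ch'] := dh x Dx; have [dHx cH'] := dH x Dx.
split; first exact: (cderM id_continuous dhx dHx).
have ch := C1_on_continuous Ch Dx; have cH := C1_on_continuous CH Dx.
exact: (cvgD (cvgM ch' cH) (cvgM ch cH')).
Qed.

Lemma C1_onB D h H : C1_on D h -> C1_on D H -> C1_on D (fun x => h x - H x).
Proof.
move=> Ch CH; have [h' dh] := Ch; have [H' dH] := CH.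
exists (fun x => h' x - H' x) => x Dx.
have [dhx ch'] := dh x Dx; have [dHx cH'] := dH x Dx.
split; first exact: (cderB id_continuous dhx dHx).
exact: (cvgB ch' cH').
Qed.

Lemma C1_on_poly D (p : {poly C}) : C1_on D (horner p).
Proof. by have := family_C1 (@family_poly _ D p). Qed.

Lemma fst_RC_continuous (p : R * R) : {for p, continuous (fun p : R * R => RC p.1)}.
Proof.
case: p => x y.
exact: (cvg_comp _ _ (cvg_fst (F := nbhs x) (G := nbhs y)) (@RtoC_continuous R x)).
Qed.

Lemma snd_cis_continuous (p : R * R) : {for p, continuous (fun p : R * R => cis
  p.2)}.
Proof.
case: p => x y.
exact: (cvg_comp _ _ (cvg_snd (F := nbhs x) (G := nbhs y)) (@cis_continuous y)).
Qed.

Lemma snd_dcis_continuous (p : R * R) : {for p, continuous (fun p : R * R =>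
  dcis p.2)}.
Proof.
case: p => x y.
exact: (cvg_comp _ _ (cvg_snd (F := nbhs x) (G := nbhs y)) (@dcis_continuous y)).
Qed.


(** The contraction needs 1 inside an open interval of scales s. Scales in [-1, 1] stay in the
    closed disc; compactness of [0, 2 pi] provides the margin beyond 1. *)
Lemma circle_tube (D : set C) c r : open D -> 0 < r -> closed_disc (c, r) `<=` D ->
  exists2 v : R, 1 < v & forall s t, -1 <= s <= v -> 0 <= t <= pi *+ 2 ->
    D (c + RC s * (RC r * cis t)).
Proof.
move=> oD r0 cD.
have inD s t : -1 <= s <= 1 -> D (c + RC s * (RC r * cis t)).
  move=> sI; apply: cD; rewrite /closed_disc /= [c + _]addrC addrK normCE lecR.
  rewrite !cabsM cabs_cis !cabsR mulr1 (gtr0_norm r0).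
  by rewrite -[leRHS]mul1r ler_wpM2r ?(ltW r0) // ler_norml.
have cg (p : R * R) : {for p, continuous (fun p : R * R => c + RC p.2 * (RC r *
  cis p.1) : C)}.
  case: p => x y.
  have c1 : {for (x, y), continuous (fun p : R * R => cis p.1)}.
    exact: (cvg_comp _ _ (cvg_fst (F := nbhs x) (G := nbhs y)) (@cis_continuous x)).
  have c2 : {for (x, y), continuous (fun p : R * R => RC p.2)}.
    exact: (cvg_comp _ _ (cvg_snd (F := nbhs x) (G := nbhs y)) (@RtoC_continuous
      R y)).
  exact: (cvgD (cvg_cst _) (cvgM c2 (cvgM (cvg_cst _) c1))).
have /compact_near_coveringP/(_ R (nbhs (1 : R))
    (fun s t => D (c + RC s * (RC r * cis t)))) := @segment_compact R 0 (pi *+ 2).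
case.
  move=> t _; apply: (cg (t, 1)); apply: open_nbhs_nbhs; split; first exact: oD.
  by apply: inD; rewrite lexx lerNl (le_trans _ ler01) // oppr_le0.
move=> e /= e0 eD; exists (1 + e / 2); first by rewrite ltrDl divr_gt0.
move=> s t /andP[s1 s2] tI; have [s3|s3] := leP s 1.
  by apply: inD; rewrite s1 s3.
apply: eD; last by rewrite /= in_itv.
rewrite /= ltr0_norm ?subr_lt0 // opprB ltrBlDl (le_lt_trans s2) // ltrD2l.
by rewrite ltr_pdivrMr // ltr_pMr // ltr1n.
Qed.

(** The circle shrinks to its centre through the points c + s r e^(it), and at s = 0 the integrand
    is zero. *)
Lemma circle_cauchy (D : set C) c r h : open D -> 0 < r ->
  closed_disc (c, r) `<=` D -> C1_on D h -> circle_integral c r h = 0.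
Proof.
move=> oD r0 cD [h' dh]; have [v v1 vD] := circle_tube oD r0 cD.
pose w s t := c + RC s * (RC r * cis t).
pose k s t := h (w s t) * (RC s * (RC r * dcis t)).
pose m s t := h (w s t) * (RC r * cis t).
pose k1 s t := h' (w s t) * (RC r * cis t) * (RC s * (RC r * dcis t)) +
  h (w s t) * (RC r * dcis t).
have RCc : continuous RC := @RtoC_continuous R.
have dws s t : cder RC (w^~ t) s (RC r * cis t).
  have := cderD (cder_cst RC s c)
    (cderM RCc (cder_io RC s) (cder_cst RC s (RC r * cis t))).
  by rewrite mulr0 addr0 mul1r add0r.
have dwt s t : cder RC (w s) t (RC s * (RC r * dcis t)).
  have := cderD (cder_cst RC t c)
    (cderZ RCc (RC s) (cderZ RCc (RC r) (cder_cis t))).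
  by rewrite add0r.
have dk s t : D (w s t) -> cder RC (k^~ t) s (k1 s t).
  move=> Dw; have [dhw _] := dh _ Dw.
  have := cderM RCc (cder_comp RCc (dws s t) dhw)
    (cderM RCc (cder_io RC s) (cder_cst RC s (RC r * dcis t))).
  by rewrite mulr0 addr0 mul1r.
have dm s t : D (w s t) -> cder RC (m s) t (k1 s t).
  move=> Dw; have [dhw _] := dh _ Dw.
  have := cderM RCc (cder_comp RCc (dwt s t) dhw) (cderZ RCc (RC r) (cder_cis t)).
  by apply: cder_eq; rewrite /k1; congr (_ + _); rewrite mulrAC.
have cw p : {for p, continuous (fun p : R * R => w p.1 p.2)}.
  have c1 := @fst_RC_continuous p; have c2 := @snd_cis_continuous p.
  exact: (cvgD (cvg_cst _) (cvgM c1 (cvgM (cvg_cst _) c2))).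
have ck1 s t : D (w s t) -> {for (s, t), continuous (fun p : R * R => k1 p.1 p.2)}.
  move=> Dw; have [dhw ch'] := dh _ Dw.
  have ch := cder_continuous (id_continuous _) dhw.
  have ch'w : {for (s, t), continuous (fun p : R * R => h' (w p.1 p.2))}.
    exact: (cvg_comp _ _ (@cw (s, t)) ch').
  have chw : {for (s, t), continuous (fun p : R * R => h (w p.1 p.2))}.
    exact: (cvg_comp _ _ (@cw (s, t)) ch).
  have c1 := @fst_RC_continuous (s, t); have c2 := @snd_cis_continuous (s, t).
  have c3 := @snd_dcis_continuous (s, t).
  have c4 : {for (s, t), continuous (fun p : R * R => RC r * dcis p.2)}.
    exact: (cvgM (cvg_cst _) c3).
  exact: (cvgD (cvgM (cvgM ch'w (cvgM (cvg_cst _) c2)) (cvgM c1 c4)) (cvgM chw c4)).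
have ck s t : D (w s t) -> {for t, continuous (k s)}.
  move=> Dw; have [dhw _] := dh _ Dw.
  have chw : {for t, continuous (fun t => h (w s t))} :=
    cder_continuous (@RCc t) (cder_comp RCc (dwt s t) dhw).
  exact: (cvgM chw (cvgM (cvg_cst _) (cvgM (cvg_cst _) (@dcis_continuous t)))).
have := @cintegral_homotopy R k k1 m (-1) v (pi *+ 2) _ v1 pi2_gt0.
rewrite circle_integralE.
have -> : (fun t => h (circle c r t) * (RC r * dcis t)) = k 1.
  by apply/funext => t; rewrite /k /w /RC rmorph1 !mul1r.
move=> ->.
- have -> : k 0 = fun t => 0 * dcis t.
    by apply/funext => t; rewrite /k /RC rmorph0 !mul0r mulr0.
  rewrite cintegralZ ?mul0r // => t _; exact: dcis_continuous.
- by rewrite ltrN10.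
- move=> s t sI tI; have Dw : D (w s t) by exact: vD.
  by split; [exact: dk|exact: dm|exact: ck|exact: ck1].
- by move=> s; rewrite /m /w cis_period.
Qed.

(** The pole moves rather than the circle: it is carried along a segment to the centre, where the
    integrand becomes the constant i. *)
Lemma circle_integral_inv c r a : 0 < r -> cabs (a - c) < r ->
  circle_integral c r (fun w => (w - a)^-1) = 0 +i* (pi *+ 2).
Proof.
move=> r0 ar; pose d := a - c; have RCc : continuous RC := @RtoC_continuous R.
(* Since cabs d < r, this choice gives both v > 1 and v cabs d < r, so that r e^(it) - s d does not
   vanish for -1 <= s <= v. *)
pose v := 2 * r / (cabs d + r).
have d0 : 0 <= cabs d := cabs_ge0 _.
have dr0 : 0 < cabs d + r by rewrite ltr_wpDl.
have v1 : 1 < v by rewrite /v ltr_pdivlMr // mul1r; rewrite /d in d0 dr0 *; lra.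
have vd : v * cabs d < r.
  rewrite /v mulrAC ltr_pdivrMr // -subr_gt0.
  have -> : r * (cabs d + r) - 2 * r * cabs d = r * (r - cabs d) by ring.
  by rewrite mulr_gt0 // subr_gt0.
pose q s t := RC r * cis t - RC s * d.
have q0 s t : -1 <= s <= v -> q s t != 0.
  move=> /andP[s1 sv]; rewrite subr_eq0; apply/eqP => /(congr1 (@cabs R)).
  rewrite !cabsM cabs_cis !cabsR mulr1 (gtr0_norm r0) => rE.
  have : `|s| * cabs d <= v * cabs d.
    by rewrite ler_wpM2r // ler_norml sv andbT (le_trans _ s1) // lerN2 ltW.
  by rewrite -rE leNgt vd.
pose k s t := RC r * dcis t * (q s t)^-1.
pose k1 s t := RC r * dcis t * (d / q s t ^+ 2).
pose m s t := - d * (q s t)^-1.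
have dqs s t : cder RC (q^~ t) s (- d).
  have := cderB RCc (cder_cst RC s (RC r * cis t))
    (cderM RCc (cder_io RC s) (cder_cst RC s d)).
  by rewrite mulr0 addr0 mul1r add0r.
have dqt s t : cder RC (q s) t (RC r * dcis t).
  have := cderB RCc (cderZ RCc (RC r) (cder_cis t)) (cder_cst RC t (RC s * d)).
  by rewrite subr0.
have cq p : {for p, continuous (fun p : R * R => q p.1 p.2)}.
  have c1 := @fst_RC_continuous p; have c2 := @snd_cis_continuous p.
  exact: (cvgB (cvgM (cvg_cst _) c2) (cvgM c1 (cvg_cst _))).
have := @cintegral_homotopy R k k1 m (-1) v (pi *+ 2) _ v1 pi2_gt0.
rewrite circle_integralE.
have -> : (fun t => (circle c r t - a)^-1 * (RC r * dcis t)) = k 1.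
  apply/funext => t; rewrite /k mulrC /q /RC rmorph1 mul1r /d opprB /circle.
  by rewrite [c + _]addrC addrA.
move=> ->.
- have -> : k 0 = fun t => 'i : C.
    apply/funext => t; rewrite /k /q /RC rmorph0 mul0r subr0 dcisE.
    rewrite mulrCA mulfK // mulf_neq0 ?cis_neq0 //.
    by rewrite -cabs_eq0 cabsR normr_eq0 gt_eqF.
  rewrite (@cintegral_FTC _ _ _ (fun t => 'i * RC t) pi2_gt0).
  + by rewrite /RC rmorph0 mulr0 subr0; apply/eqP; rewrite eq_complex /=;
    apply/andP; split; apply/eqP; ring.
  + by move=> t _; exact: cvg_cst.
  + by move=> t _; have := cderZ RCc ('i : C) (cder_io RC t); rewrite mulr1.
- by rewrite ltrN10.
- move=> s t sI tI; split.
  + have := cderZ RCc (RC r * dcis t) (cderV (f := q^~ t) RCc (q0 s t sI) (dqs s t)).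
    by rewrite opprK.
  + have := cderZ RCc (- d) (cderV (f := q s) RCc (q0 s t sI) (dqt s t)).
    by apply: cder_eq; rewrite /k1; ring.
  + have cqt := cder_continuous (@RCc t) (dqt s t).
    exact: (cvgM (cvgM (cvg_cst _) (@dcis_continuous t)) (cvgV (q0 s t sI) cqt)).
  + have c3 := @snd_dcis_continuous (s, t).
    have cqst := @cq (s, t).
    have q2 : q s t ^+ 2 != 0 by rewrite expf_neq0 // q0.
    exact: (cvgM (cvgM (cvg_cst _) c3) (cvgM (cvg_cst _) (cvgV q2 (cvgM cqst
      cqst)))).
- by move=> s; rewrite /m /q cis_period.
Qed.

End circle.

(** * Contours: finite unions of circles *)

Section contour.
Variable R : realType.
Local Notation C := (CC R).
Implicit Types (D : set C) (G : seq (C * R)) (h H : C -> C) (a w : C) (l : seq C).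

Definition contour_integral G h : C := \sum_(c <- G) circle_integral c.1 c.2 h.

Definition contour G := forall c, c \in G -> 0 < c.2.

Definition contour_continuous G h :=
  forall c, c \in G -> circle_continuous_at c.1 c.2 h.

Definition two_pi_i : C := 0 +i* (pi *+ 2).

Lemma two_pi_i_neq0 : two_pi_i != 0.
Proof. by rewrite eq_complex /= negb_and (gt_eqF (pi2_gt0 R)) orbT. Qed.

Lemma eq_contour_integral G h H : contour G ->
  (forall c, c \in G -> forall w, cabs (w - c.1) = c.2 -> h w = H w) ->
  contour_integral G h = contour_integral G H.
Proof.
move=> G0 hH; apply: eq_big_seq => c cG.
by apply: eq_circle_integral; [exact/ltW/G0|exact: hH].
Qed.

Lemma contour_integralD G h H : contour G ->
  contour_continuous G h -> contour_continuous G H ->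
  contour_integral G (fun w => h w + H w) =
  contour_integral G h + contour_integral G H.
Proof.
move=> G0 ch cH; rewrite /contour_integral -big_split.
by apply: eq_big_seq => c cG; apply: circle_integralD; [exact/ltW/G0|exact:
  ch|exact: cH].
Qed.

Lemma contour_integralZ G a h : contour G -> contour_continuous G h ->
  contour_integral G (fun w => a * h w) = a * contour_integral G h.
Proof.
move=> G0 ch; rewrite /contour_integral big_distrr.
by apply: eq_big_seq => c cG; apply: circle_integralZ; [exact/ltW/G0|exact: ch].
Qed.

Lemma contour_continuousD G h H : contour_continuous G h ->
  contour_continuous G H -> contour_continuous G (fun w => h w + H w).
Proof. by move=> ch cH c cG w wc; exact: (cvgD (ch c cG w wc) (cH c cG w wc)). Qed.

Lemma contour_continuousM G h H : contour_continuous G h ->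
  contour_continuous G H -> contour_continuous G (fun w => h w * H w).
Proof. by move=> ch cH c cG w wc; exact: (cvgM (ch c cG w wc) (cH c cG w wc)). Qed.

Lemma contour_continuous_cst G a : contour_continuous G (fun=> a).
Proof. by move=> c cG w wc; exact: (@cst_continuous C C a w). Qed.

Lemma contour_continuous_sum G (I : Type) (s : seq I) (F : I -> C -> C) :
  (forall i, contour_continuous G (F i)) ->
  contour_continuous G (fun w => \sum_(i <- s) F i w).
Proof.
move=> cF; elim: s => [|i s IH].
  have -> : (fun w => \sum_(i <- [::]) F i w) = fun=> 0.
    by apply/funext => w; rewrite big_nil.
  exact: contour_continuous_cst.
have -> : (fun w => \sum_(j <- i :: s) F j w) = fun w => F i w + \sum_(j <- s) F j w.
  by apply/funext => w; rewrite big_cons.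
exact: (contour_continuousD (cF i) IH).
Qed.

Lemma contour_integral_sum G (I : Type) (s : seq I) (F : I -> C -> C) : contour G ->
  (forall i, contour_continuous G (F i)) ->
  contour_integral G (fun w => \sum_(i <- s) F i w) =
  \sum_(i <- s) contour_integral G (F i).
Proof.
move=> G0 cF; elim: s => [|i s IH].
  have -> : (fun w => \sum_(i <- [::]) F i w) = fun=> 0 * 0.
    by apply/funext => w; rewrite big_nil mul0r.
  rewrite contour_integralZ // ?big_nil ?mul0r //.
  exact: contour_continuous_cst.
have -> : (fun w => \sum_(j <- i :: s) F j w) = fun w => F i w + \sum_(j <- s) F j w.
  by apply/funext => w; rewrite big_cons.
rewrite (contour_integralD G0 (cF i) (contour_continuous_sum (s := s) cF)).
by rewrite IH big_cons.
Qed.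

Lemma contour_cauchy G D h : contour G -> open D ->
  (forall c, c \in G -> closed_disc c `<=` D) -> C1_on D h ->
  contour_integral G h = 0.
Proof.
move=> G0 oD GD Ch; rewrite /contour_integral big_seq big1 // => -[c r] cG.
by apply: circle_cauchy oD _ _ Ch; [exact: (G0 _ cG)|exact: GD cG].
Qed.

Lemma contour_C1_continuous G D h : contour G ->
  (forall c, c \in G -> closed_disc c `<=` D) -> C1_on D h -> contour_continuous G h.
Proof.
move=> G0 GD Ch c cG w wc; apply: C1_on_continuous Ch _; apply: (GD c cG).
by rewrite /closed_disc /= normCE wc lexx.
Qed.

(** Index one, stated combinatorially: [a] lies on none of the circles and inside exactly one. *)
Definition winds_once G a := (forall c, c \in G -> cabs (a - c.1) != c.2) /\
  count (fun c => cabs (a - c.1) < c.2) G = 1%N.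

Lemma cder_subr a w : cder id (fun w : C => w - a) w 1.
Proof.
have := cderB id_continuous (cder_io id w) (cder_cst _ w a).
by rewrite subr0.
Qed.

Lemma subr_continuous a : continuous (fun w : C => w - a).
Proof. by move=> w; exact: (cder_continuous (id_continuous _) (cder_subr a w)). Qed.

Lemma winds_neq0 G a c w : winds_once G a -> c \in G -> cabs (w - c.1) = c.2 ->
  w - a != 0.
Proof. by move=> [aG _] cG wc; rewrite subr_eq0; apply: contra_neq (aG c cG) =>
  <-. Qed.

Lemma contour_integral_inv G a : contour G -> winds_once G a ->
  contour_integral G (fun w => (w - a)^-1) = two_pi_i.
Proof.
move=> G0 aG; rewrite -[RHS]mulr1n -aG.2 -[RHS]addr0 -iter_addr -big_const_seq.
rewrite [RHS]big_mkcond; apply: eq_big_seq => c cG; have r0 := G0 c cG.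
case: ifPn => ac.
  by apply: circle_integral_inv.
rewrite -leNgt le_eqVlt eq_sym (negbTE (aG.1 c cG)) /= in ac.
(* A circle that does not surround [a] has its closed disc in the domain of 1 / (w - a). *)
pose D : set C := [set w | w - a != 0].
apply: (@circle_cauchy _ D) => //.
- move=> w /= wa; have /nbhsC[e e0 eP] : nbhs w [set v : C | v != a].
    apply/nbhsC; exists (cabs (w - a)) => [|y]; first by rewrite cabs_gt0.
    by apply: contraTneq => ->; rewrite -cabsN opprB ltxx.
  by apply/nbhsC; exists e => // y /eP; rewrite /D /= subr_eq0.
- move=> w; rewrite /closed_disc /= normCE lecR => wc; rewrite /D /= subr_eq0.
  by apply: contraTneq wc => ->; rewrite -ltNge.
- exists (fun w => - 1 / (w - a) ^+ 2) => w wa; split.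
    exact: (cderV (f := fun w => w - a) id_continuous wa (cder_subr a w)).
  have w2 : (w - a) ^+ 2 != 0 by rewrite expf_neq0.
  have cw := @subr_continuous a w.
  exact: (cvgM (cvg_cst _) (cvgV w2 (cvgM cw cw))).
Qed.

Definition inv_prod l w : C := (\prod_(a <- l) (w - a))^-1.

Lemma contour_continuous_inv_prod G l : (forall a, a \in l -> winds_once G a) ->
  contour_continuous G (inv_prod l).
Proof.
move=> lG c cG w wc.
have : {for w, continuous (fun w => \prod_(a <- l) (w - a))}.
  elim: l {lG} => [|a l IH].
    have -> : (fun w => \prod_(a <- [::]) (w - a)) = fun=> 1.
      by apply/funext => v; rewrite big_nil.
    exact: (@cst_continuous C C 1 w).
  have -> : (fun w => \prod_(b <- a :: l) (w - b)) = fun w => (w - a) * \prod_(b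
    <- l) (w - b).
    by apply/funext => v; rewrite big_cons.
  exact: (cvgM (@subr_continuous a w) IH).
move=> cp; have p0 : \prod_(a <- l) (w - a) != 0.
  rewrite prodf_seq_neq0; apply/allP => a al /=.
  exact: winds_neq0 (lG a al) cG wc.
exact: (cvgV p0 cp).
Qed.

(** Every such power has a primitive near the circles; n = 0 gives the constant 1, with primitive w
    - a. *)
Lemma contour_integral_inv_pow G n a : contour G -> winds_once G a -> n != 1%N ->
  contour_integral G (fun w => ((w - a) ^+ n)^-1) = 0.
Proof.
move=> G0 aG n1; rewrite /contour_integral big_seq big1 // => c cG.
have r0 := G0 c cG.
have cinv : circle_continuous_at c.1 c.2 (fun w => ((w - a) ^+ n)^-1).
  move=> w wc; have w0 := winds_neq0 aG cG wc.
  have cX := cder_continuous (id_continuous w) (cderX id_continuous n (cder_subr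
    a w)).
  exact: (cvgV (expf_neq0 n w0) cX).
case: n n1 cinv => [|[|n]] // _ cinv.
  apply: (circle_integral_primitive (H := fun w => w - a)) => //; first exact: ltW.
  by move=> w wc; rewrite expr0 invr1; exact: cder_subr.
apply: (circle_integral_primitive
  (H := fun w => (- n.+1%:R^-1) * ((w - a) ^+ n.+1)^-1)) => //; first exact: ltW.
move=> w wc; have w0 := winds_neq0 aG cG wc.
have wn0 := expf_neq0 n.+1 w0.
have := cderZ id_continuous (- n.+1%:R^-1) (cderV (f := fun w => (w - a) ^+ n.+1)
  id_continuous wn0 (cderX id_continuous n.+1 (cder_subr a w))).
apply: cder_eq; rewrite /= mul1r -[(w - a) ^+ n *+ _]mulr_natr.
have k0 : n.+1%:R != 0 :> C by rewrite pnatr_eq0.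
have w0n := expf_neq0 n w0; rewrite !exprS.
move: ((w - a) ^+ n) w0n (n.+1%:R : C) k0 => e e0 k k0.
by field; rewrite k0 e0 w0.
Qed.

(** Partial fractions at two distinct entries x and y write the integrand as 1 / (x - y) times a
    difference of two products with one factor less. The integrals of these depend only on the
    number of factors, hence cancel. If all entries agree, a power remains. *)
Lemma contour_integral_inv_prod G l : contour G ->
  (forall a, a \in l -> winds_once G a) ->
  contour_integral G (inv_prod l) = two_pi_i *+ (size l == 1%N).
Proof.
move=> G0; have [n] := ubnP (size l); elim: n l => // n IH l /ltnSE ln lG.
have [/hasP[y yl /hasP[x xl xy]]|] := boolP (has (fun y => has (fun x => x != y)
  l) l).
  have pl : perm_eq l (x :: y :: rem y (rem x l)).
    apply: perm_trans (perm_to_rem xl) _; rewrite perm_cons perm_to_rem //.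
    by rewrite (rem_mem _ yl) // eq_sym.
  set l' := rem y (rem x l) in pl.
  have xG : forall a, a \in x :: l' -> winds_once G a.
    move=> a al; apply: lG; rewrite (perm_mem pl) !in_cons.
    by move: al; rewrite in_cons => /orP[->//|->]; rewrite !orbT.
  have yG : forall a, a \in y :: l' -> winds_once G a.
    by move=> a al; apply: lG; rewrite (perm_mem pl) in_cons al orbT.
  have sl : size l = (size l').+2 by rewrite (perm_size pl).
  rewrite (eq_contour_integral G0 (H := fun w =>
      (x - y)^-1 * inv_prod (x :: l') w + (- (x - y)^-1) * inv_prod (y :: l') w)).
    have cx := contour_continuous_inv_prod xG.
    have cy := contour_continuous_inv_prod yG.
    have cx' := contour_continuousM (contour_continuous_cst (G := G) (a := (x -
      y)^-1)) cx.
    have cy' := contour_continuousM (contour_continuous_cst (G := G) (a := - (x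
      - y)^-1)) cy.
    rewrite (contour_integralD G0 cx' cy').
    rewrite (contour_integralZ _ G0 cx) (contour_integralZ _ G0 cy).
    rewrite (IH (x :: l')) ?(IH (y :: l')) //=; last 2 first.
      by rewrite -sl.
      by rewrite -sl.
    rewrite sl mulr0n.
    by rewrite mulNr subrr.
  move=> c cG w wc; rewrite /inv_prod (perm_big _ pl) !big_cons /=.
  have x0 : w - x != 0 by apply: winds_neq0 (xG x (mem_head _ _)) cG wc.
  have y0 : w - y != 0 by apply: winds_neq0 (yG y (mem_head _ _)) cG wc.
  have P0 : \prod_(j <- l') (w - j) != 0.
    rewrite prodf_seq_neq0; apply/allP => b bl /=.
    by apply: winds_neq0 (xG b _) cG wc; rewrite in_cons bl orbT.
  have xy0 : x - y != 0 by rewrite subr_eq0.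
  move: (\prod_(j <- l') (w - j)) P0 => P P0.
  by field; rewrite x0 y0 P0 xy0.
case: l ln lG => [|a l] ln lG noneq.
  rewrite mulr0n (eq_contour_integral G0 (H := horner 1)).
    by apply: (contour_cauchy G0 openT) => //; exact: C1_on_poly.
  by move=> c cG w wc; rewrite /inv_prod big_nil invr1 hornerC.
have la : l = nseq (size l) a.
  apply/all_pred1P; apply/allP => x xl; apply: contraT => xa.
  case/negP: noneq; apply/hasP; exists a; rewrite ?mem_head //.
  by apply/hasP; exists x => //; rewrite in_cons xl orbT.
have prodE w : inv_prod (a :: l) w = ((w - a) ^+ (size l).+1)^-1.
  by rewrite /inv_prod big_cons {1}la big_nseq /= iter_mulr_1 -exprS.
have -> : inv_prod (a :: l) = fun w => ((w - a) ^+ (size l).+1)^-1.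
  exact/funext.
have aG : winds_once G a by apply: lG; rewrite mem_head.
rewrite [size _]/=; have [->|n1] := eqVneq (size l).+1 1%N.
  by under eq_fun do rewrite expr1; exact: contour_integral_inv.
exact: contour_integral_inv_pow.
Qed.

End contour.

(** * The matrix function *)

Section resolvent.
Variables (K : fieldType) (n : nat).
Implicit Types (l : seq K) (w a : K) (B : 'M[K]_n.+1) (i j : 'I_n.+1).

(* Newton's expansion of (w 1 - B)^-1, exact when l lists the roots of char_poly
  B. *)
Fixpoint newton_res l w B : 'M[K]_n.+1 :=
  if l is a :: l' then (w - a)^-1 *: (1 + (B - a%:M) * newton_res l' w B) else 0.

(** Telescoping, from w - B = (w - a) - (B - a). The product on the right is the defect, which
    Cayley-Hamilton makes zero once [l] lists all roots. *)
Lemma mul_newton_res l w B : (forall a, a \in l -> w - a != 0) ->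
  (w%:M - B) * newton_res l w B = 1 - \prod_(a <- l) ((w - a)^-1 *: (B - a%:M)).
Proof.
elim: l => [|a l IH] wl; first by rewrite big_nil mulr0 subrr.
have wa : w - a != 0 by rewrite wl ?mem_head.
rewrite big_cons /= -scalerAr mulrDr mulr1 mulrA.
have -> : (w%:M - B) * (B - a%:M) = (B - a%:M) * (w%:M - B).
  have sC x (A : 'M[K]_n.+1) : x%:M * A = A * x%:M.
    by rewrite -!mulmxE mul_scalar_mx mul_mx_scalar.
  rewrite !mulrBl !mulrBr (sC w B) (sC a B) (sC a w%:M).
  by rewrite !opprB addrACA [RHS]addrACA; congr (_ + _); rewrite addrC.
rewrite -mulrA IH => [|b bl]; last by rewrite wl // in_cons bl orbT.
rewrite mulrBr mulr1 addrA [w%:M - B + _]addrA subrK -raddfB /= scalerBr.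
by rewrite scale_scalar_mx mulVf // scalerAl.
Qed.

Lemma prod_scale_mx (I : Type) (s : seq I) (c : I -> K) (F : I -> 'M[K]_n.+1) :
  \prod_(i <- s) (c i *: F i) = (\prod_(i <- s) c i) *: \prod_(i <- s) F i.
Proof.
elim: s => [|x s IH]; first by rewrite !big_nil scale1r.
by rewrite !big_cons IH -scalerAl -scalerAr scalerA.
Qed.

Lemma newton_resP l w B : char_poly B = \prod_(a <- l) ('X - a%:P) ->
  (forall a, a \in l -> w - a != 0) ->
  (w%:M - B) *m newton_res l w B = 1%:M.
Proof.
move=> lB wl; have := mul_newton_res B wl.
rewrite prod_scale_mx.
have -> : \prod_(a <- l) (B - a%:M) = horner_mx B (char_poly B).
  rewrite lB rmorph_prod; apply: eq_bigr => a _.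
  by rewrite rmorphB /= horner_mx_X horner_mx_C.
by rewrite Cayley_Hamilton scaler0 subr0.
Qed.

Lemma invmx_newton_res l w B : char_poly B = \prod_(a <- l) ('X - a%:P) ->
  (forall a, a \in l -> w - a != 0) -> invmx (w%:M - B) = newton_res l w B.
Proof.
move=> lB wl; have H := newton_resP lB wl; have [u _] := mulmx1_unit H.
by rewrite -[LHS]mulmx1 -H mulKmx.
Qed.

(** An entry of (w - B) N = 1, in the form that trades a factor w under the integral for a factor
    [B]. *)
Lemma newton_res_shift l w B i j : char_poly B = \prod_(a <- l) ('X - a%:P) ->
  (forall a, a \in l -> w - a != 0) ->
  w * newton_res l w B i j = (i == j)%:R + \sum_k B i k * newton_res l w B k j.
Proof.
move=> lB wl; have := newton_resP lB wl; rewrite mulmxBl mul_scalar_mx.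
move=> /matrixP /(_ i j); rewrite !mxE => /eqP; rewrite subr_eq => /eqP ->.
by [].
Qed.

(** When [l] lists the roots of [char_poly B], these are the entries of the adjugate of w - B as
    polynomials in w: the resolvent with its denominators cleared. *)
Fixpoint newton_adj l B i j : {poly K} :=
  if l is a :: l' then (i == j)%:R *: \prod_(b <- l') ('X - b%:P) +
    \sum_k (B - a%:M) i k *: newton_adj l' B k j
  else 0.

Lemma newton_adjE l w B i j : (forall a, a \in l -> w - a != 0) ->
  (\prod_(a <- l) (w - a)) * newton_res l w B i j = (newton_adj l B i j).[w].
Proof.
elim: l i j => [|a l IH] i j wl; first by rewrite /= mxE mulr0 horner0.
have wa : w - a != 0 by rewrite wl ?mem_head.
rewrite big_cons /= mxE mulrCA !mulrA mulVf // mul1r !mxE hornerD hornerZ mulrDr.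
rewrite horner_prod [_ * _%:R]mulrC; congr (_ * _ + _).
  by apply: eq_bigr => b _; rewrite hornerXsubC.
rewrite horner_sum mulr_sumr; apply: eq_bigr => k _.
rewrite hornerZ -IH => [|b bl]; last by rewrite wl // in_cons bl orbT.
by rewrite mulrCA.
Qed.

End resolvent.

Section contour_resolvent.
Variables (R : realType) (n : nat).
Local Notation C := (CC R).
Implicit Types (D : set C) (G : seq (C * R)) (l : seq C) (B : 'M[C]_n.+1).

Lemma contour_continuous_newton_res G l B i j :
  (forall a, a \in l -> winds_once G a) ->
  contour_continuous G (fun w => newton_res l w B i j).
Proof.
elim: l i j => [|a l IH] i j lG.
  have -> : (fun w => newton_res [::] w B i j) = fun=> 0.
    by apply/funext => w; rewrite mxE.
  exact: contour_continuous_cst.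
have lG' : forall b, b \in l -> winds_once G b.
  by move=> b bl; apply: lG; rewrite in_cons bl orbT.
have aG : forall b, b \in [:: a] -> winds_once G b.
  by move=> b; rewrite inE => /eqP ->; apply: lG; rewrite mem_head.
have -> : (fun w => newton_res (a :: l) w B i j) = fun w => inv_prod [:: a] w *
    ((i == j)%:R + \sum_k (B - a%:M) i k * newton_res l w B k j).
  by apply/funext => w; rewrite /inv_prod big_seq1 /= !mxE.
have c1 := contour_continuous_inv_prod aG.
have c2 k : contour_continuous G (fun w => (B - a%:M) i k * newton_res l w B k j).
  exact: (contour_continuousM (contour_continuous_cst (a := (B - a%:M) i k)) (IH
    k j lG')).
have c3 := contour_continuous_sum (s := index_enum 'I_n.+1) c2.
exact: (contour_continuousM c1
  (contour_continuousD (contour_continuous_cst (a := (i == j)%:R)) c3)).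
Qed.

(** The list [pre] collects the factors 1 / (w - a) already extracted, which makes the recursion of
    [newton_res] an induction. Only a summand with a single factor contributes, and it arises in the
    first step with [pre] empty. *)
Lemma contour_integral_inv_prod_res G pre l B i j : contour G ->
  (forall a, a \in pre ++ l -> winds_once G a) ->
  contour_integral G (fun w => inv_prod pre w * newton_res l w B i j) =
  two_pi_i R *+ [&& nilp pre, ~~ nilp l & i == j].
Proof.
move=> G0; elim: l pre i j => [|a l IH] pre i j plG.
  have cpre : contour_continuous G (inv_prod pre).
    by apply: contour_continuous_inv_prod => a ap; apply: plG; rewrite cats0.
  rewrite andbF mulr0n -[RHS](mul0r (contour_integral G (inv_prod pre))).
  rewrite -contour_integralZ //; congr contour_integral.
  by apply/funext => w; rewrite mxE mulr0 mul0r.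
have preG : forall b, b \in a :: pre -> winds_once G b.
  move=> b bp; apply: plG; rewrite mem_cat in_cons; move: bp; rewrite in_cons.
  by move=> /orP[->|->]; rewrite ?orbT.
have lG : forall b, b \in l -> winds_once G b.
  by move=> b bl; apply: plG; rewrite mem_cat in_cons bl !orbT.
have cpre := contour_continuous_inv_prod preG.
have cr k := contour_continuousM cpre (contour_continuous_newton_res (B := B) (i
  := k) (j := j) lG).
have ck k := contour_continuousM (contour_continuous_cst (a := (B - a%:M) i k))
  (cr k).
have cs := contour_continuous_sum (s := index_enum 'I_n.+1) ck.
have cd := contour_continuousM (contour_continuous_cst (a := (i == j)%:R)) cpre.
have -> : (fun w => inv_prod pre w * newton_res (a :: l) w B i j) = fun w =>
    (i == j)%:R * inv_prod (a :: pre) w +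
    \sum_k (B - a%:M) i k * (inv_prod (a :: pre) w * newton_res l w B k j).
  apply/funext => w; rewrite /inv_prod big_cons /= mxE [in LHS]mxE invfM.
  rewrite [X in _ * (_ * (X + _))]mxE [X in _ * (_ * (_ + X))]mxE.
  rewrite mulrA mulrDr [_ * (i == j)%:R]mulrC [_ * (w - a)^-1]mulrC; congr (_ + _).
  rewrite mulr_sumr; apply: eq_bigr => k _; by rewrite mulrCA.
rewrite (contour_integralD G0 cd cs) (contour_integralZ _ G0 cpre).
rewrite (contour_integral_sum _ G0 ck) big1 ?addr0 => [|k _]; last first.
  rewrite (contour_integralZ _ G0 (cr k)) IH ?mulr0 // => b.
  rewrite cat_cons in_cons mem_cat => bl; apply: plG; rewrite mem_cat in_cons.
  by case/or3P: bl => ->; rewrite ?orbT.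
rewrite contour_integral_inv_prod //= eqSS mulr_natl -mulrnA mulnb.
by rewrite andbC /nilp; case: pre {IH plG preG cpre cr ck cs cd}.
Qed.

Lemma contour_integral_newton_res G l B i j : contour G ->
  char_poly B = \prod_(a <- l) ('X - a%:P) ->
  (forall a, a \in l -> winds_once G a) ->
  contour_integral G (fun w => newton_res l w B i j) = two_pi_i R *+ (i == j).
Proof.
move=> G0 lB lG; have := contour_integral_inv_prod_res (pre := [::]) B i j G0 lG.
(* The characteristic polynomial of a matrix of size n + 1 is not constant. *)
have -> : ~~ nilp l.
  apply: contra_eqN lB => /nilP ->; rewrite big_nil.
  by apply: contra_eqN (size_char_poly B) => /eqP ->; rewrite size_poly1.
move=> /= <-; congr contour_integral; apply/funext => w.
by rewrite /inv_prod big_nil invr1 mul1r.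
Qed.

Lemma contour_continuous_horner G (p : {poly C}) : contour G ->
  contour_continuous G (horner p).
Proof.
by move=> G0; apply: (contour_C1_continuous (D := setT) G0) => //; exact: C1_on_poly.
Qed.

Lemma contour_integral_poly G (p : {poly C}) : contour G -> contour_integral G
  (horner p) = 0.
Proof.
by move=> G0; apply: (contour_cauchy G0 openT) => //; exact: C1_on_poly.
Qed.

(** Induction along Horner's scheme: w times the resolvent is 1 plus [B] times the resolvent, and
    the polynomial part integrates to zero. *)
Lemma contour_integral_poly_res G l B (p : {poly C}) i j : contour G ->
  char_poly B = \prod_(a <- l) ('X - a%:P) ->
  (forall a, a \in l -> winds_once G a) ->
  contour_integral G (fun w => p.[w] * newton_res l w B i j) =
  two_pi_i R * horner_mx B p i j.
Proof.
move=> G0 lB lG; have cN k := contour_continuous_newton_res (B := B) (i := k) (j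
  := j) lG.
elim/poly_ind: p i => [|p c IH] i.
  rewrite rmorph0 mxE mulr0 -[RHS](mul0r (contour_integral G (fun w =>
    newton_res l w B i j))).
  rewrite -contour_integralZ //; congr contour_integral.
  by apply/funext => w; rewrite horner0.
have cp := contour_continuous_horner (p := p) G0.
have cpN k := contour_continuousM cp (cN k).
have ck k := contour_continuousM (contour_continuous_cst (a := B i k)) (cpN k).
have cs := contour_continuous_sum (s := index_enum 'I_n.+1) ck.
have cd := contour_continuousM (contour_continuous_cst (a := (i == j)%:R)) cp.
have cc := contour_continuousM (contour_continuous_cst (a := c)) (cN i).
rewrite (eq_contour_integral G0 (H := fun w => c * newton_res l w B i j +
    ((i == j)%:R * p.[w] + \sum_k B i k * (p.[w] * newton_res l w B k j)))).
  rewrite (contour_integralD G0 cc (contour_continuousD cd cs)).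
  rewrite (contour_integralD G0 cd cs) (contour_integralZ _ G0 cp).
  rewrite (contour_integralZ _ G0 (cN i)) (contour_integral_sum _ G0 ck).
  rewrite contour_integral_poly // mulr0 add0r contour_integral_newton_res //.
  under eq_bigr => k _ do rewrite (contour_integralZ _ G0 (cpN k)) IH mulrCA.
  rewrite -mulr_sumr rmorphD rmorphM /= horner_mx_X horner_mx_C.
  have -> : horner_mx B p * B = B *m horner_mx B p.
    exact: comm_horner_mx p (comm_mx_refl B).
  rewrite !mxE mulrDr addrC; congr (_ + _).
  by rewrite mulrnAr [RHS]mulrnAr mulrC.
move=> d dG w wd; rewrite hornerMXaddC mulrDl addrC; congr (_ + _).
rewrite -mulrA newton_res_shift // => [|a al]; last exact: winds_neq0 (lG a al)
  dG wd.
rewrite mulrDr [p.[w] * _%:R]mulrC; congr (_ + _).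
by rewrite mulr_sumr; apply: eq_bigr => k _; rewrite mulrCA.
Qed.

Lemma char_poly_roots B : exists2 l, char_poly B = \prod_(a <- l) ('X - a%:P) &
  forall a, spectrum B a <-> a \in l.
Proof.
have [l lB] := closed_field_poly_normal (char_poly B : {poly R[i]}).
have {}lB : char_poly B = \prod_(a <- l) ('X - a%:P).
  by rewrite [LHS]lB; have /monicP -> := char_poly_monic B; rewrite scale1r.
exists l => // a.
by rewrite /spectrum /= eigenvalue_root_char lB root_prod_XsubC.
Qed.

Lemma uniform_radius (T : eqType) (s : seq T) (P : R -> T -> Prop) :
  (forall a, a \in s -> exists2 e0 : R, 0 < e0 & forall e, 0 < e <= e0 -> P e a) ->
  exists2 e0 : R, 0 < e0 & forall e, 0 < e <= e0 -> forall a, a \in s -> P e a.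
Proof.
elim: s => [|a s IH] sP; first by exists 1.
have [e0 e00 eP] := sP a (mem_head _ _).
have [|e1 e10 e1P] := IH; first by move=> b bs; apply: sP; rewrite in_cons bs orbT.
exists (Num.min e0 e1); first by rewrite lt_min e00.
move=> e /andP[e_gt0]; rewrite le_min => /andP[ee0 ee1] b.
rewrite in_cons => /orP[/eqP ->|bs]; first by apply: eP; rewrite e_gt0.
by apply: e1P; rewrite // e_gt0.
Qed.

(** The closed discs are pairwise disjoint, so a point interior to one is strictly outside all
    others. *)
Lemma encloses_winds_once D B G a : encloses_spectrum D B G ->
  spectrum B a -> winds_once G a.
Proof.
move=> [GD Gdisj GB] /GB[c cG ac].
have {ac} : cabs (a - c.1) < c.2 by move: ac; rewrite /open_disc /= normCE ltcR.
have GD' : forall c, c \in G -> 0 < c.2 by move=> c' /GD[].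
move: Gdisj GD' cG {GD GB}; elim: G c => // e G IH c /=.
move=> /andP[/allP eG pG] Ge; rewrite in_cons => /orP[/eqP ->|cG] ac.
  have out c' : c' \in G -> c'.2 < cabs (a - c'.1).
    move=> c'G; rewrite ltNge; apply/negP => ac'.
    have /asboolP/eqP := eG c' c'G; apply/negP/set0P; exists a.
    by split; rewrite /closed_disc /= normCE lecR // ltW.
  split=> [c'|]; first by rewrite in_cons => /orP[/eqP ->|/out]; [rewrite
    lt_eqF|move/gt_eqF/negbT].
  rewrite /= ac -[RHS]addn0; congr (_ + _)%N; apply/eqP; rewrite -leqn0 leqNgt
    -has_count.
  by apply/hasPn => c' /out; rewrite -leNgt => /ltW.
have [|aG aG1] := IH c pG _ cG ac; first by move=> c' c'G; apply: Ge; rewrite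
  in_cons c'G orbT.
have eout : e.2 < cabs (a - e.1).
  rewrite ltNge; apply/negP => ae.
  have /asboolP/eqP := eG c cG; apply/negP/set0P; exists a.
  by split; rewrite /closed_disc /= normCE lecR // ltW.
split=> [c'|]; first by rewrite in_cons => /orP[/eqP ->|/aG //]; rewrite gt_eqF.
by rewrite /= aG1 ltNge ltW.
Qed.

(** The right-hand side does not mention [G], so all admissible contours give the same value. *)
Lemma contour_matfun_interp G D B f (p : {poly C}) (q : C -> C) :
  encloses_spectrum D B G -> open D -> C1_on D q ->
  (forall w, D w -> f w = p.[w] + (char_poly B).[w] * q w) ->
  contour_matfun G f B = horner_mx B p.
Proof.
move=> GE oD Cq fE; have [GD _ _] := GE.
have G0 : contour G by move=> c /GD[].
have GcD c : c \in G -> closed_disc c `<=` D by move=> /GD[].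
have [l lB lspec] := char_poly_roots B.
have lG a : a \in l -> winds_once G a.
  by move=> al; apply: (encloses_winds_once GE); exact/lspec.
apply/matrixP => i j; rewrite mxE.
pose r := newton_adj l B i j.
have cN := contour_continuous_newton_res (B := B) (i := i) (j := j) lG.
have cpN := contour_continuousM (contour_continuous_horner (p := p) G0) cN.
have Cqr : C1_on D (fun w => q w * r.[w]) by apply: C1_onM => //; exact: C1_on_poly.
have cqr := contour_C1_continuous G0 GcD Cqr.
rewrite -/(contour_integral G (fun w => f w * invmx (w%:M - B) i j)).
rewrite (eq_contour_integral G0 (H := fun w => p.[w] * newton_res l w B i j + q
  w * r.[w])).
  rewrite (contour_integralD G0 cpN cqr) (contour_integral_poly_res _ _ _ G0 lB lG).
  rewrite (contour_cauchy G0 oD GcD Cqr) addr0 mulrA mulVf ?mul1r //.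
  exact: two_pi_i_neq0.
move=> c cG w wc.
have wl a : a \in l -> w - a != 0 by move=> al; exact: winds_neq0 (lG a al) cG wc.
have Dw : D w.
  by apply: (GcD c cG); rewrite /closed_disc /= normCE wc lexx.
rewrite fE // (invmx_newton_res lB wl) mulrDl; congr (_ + _).
rewrite /r -newton_adjE // lB horner_prod mulrAC mulrC; congr (_ * (_ * _)).
by apply: eq_bigr => a _; rewrite hornerXsubC.
Qed.

Lemma encloses_exists D B : open D -> spectrum B `<=` D ->
  exists G, encloses_spectrum D B G.
Proof.
move=> oD BD; have [l0 _ l0P] := char_poly_roots B.
(* A repeated eigenvalue would produce the same disc twice, against disjointness. *)
pose l := undup l0; have lP a : spectrum B a <-> a \in l by rewrite mem_undup.
have [e1 e10 e1P] : exists2 e0 : R, 0 < e0 & forall e, 0 < e <= e0 ->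
    forall a, a \in l -> closed_disc (a, e) `<=` D.
  apply: (uniform_radius (P := fun e a => closed_disc (a, e) `<=` D)) => a /lP
    /BD Da.
  have /nbhsC[e0 e00 eP] : nbhs (a : C) D by exact: open_nbhs_nbhs.
  exists (e0 / 2); first by rewrite divr_gt0.
  move=> e /andP[_ ee0] w; rewrite /closed_disc /= normCE lecR => we.
  by apply: eP; rewrite (le_lt_trans we) // (le_lt_trans ee0) // ltr_pdivrMr //
    ltr_pMr // ltr1n.
(* Two discs of this radius around distinct eigenvalues are disjoint; a third of each distance will
   do. *)
have [e2 e20 e2P] : exists2 e0 : R, 0 < e0 & forall e, 0 < e <= e0 ->
    forall a, a \in l -> forall b, b \in l -> a != b -> e + e < cabs (a - b).
  apply: (uniform_radius (P := fun e a => forall b, b \in l -> a != b -> e + e <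
    cabs (a - b))).
  move=> a al; apply: (uniform_radius (P := fun e b => a != b -> e + e < cabs (a
    - b))).
  move=> b bl; have [->|ab] := eqVneq a b; first by exists 1.
  have ab0 : 0 < cabs (a - b) by rewrite cabs_gt0 subr_eq0.
  by exists (cabs (a - b) / 3); rewrite ?divr_gt0 // => e /andP[e0 e3] _; lra.
pose e := Num.min e1 e2.
have e0 : 0 < e by rewrite lt_min e10.
have {}e1P := e1P e; have {}e2P := e2P e.
exists [seq (a, e) | a <- l]; split.
- move=> c /mapP[a al ->]; split => //; apply: e1P => //.
  by rewrite e0 ge_min lexx.
- rewrite pairwise_map; apply/(pairwiseP 0) => i j; rewrite !inE => il jl ij.
  suff H : closed_disc (l`_i, e) `&` closed_disc (l`_j, e) = set0 by have :=
    asboolT H.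
  rewrite -subset0 => w [].
  rewrite /closed_disc /= !normCE !lecR => wi wj.
  have ij0 : l`_i != l`_j by rewrite nth_uniq ?undup_uniq // ltn_eqF.
  have e2' : 0 < e <= e2 by rewrite e0 ge_min lexx orbT.
  have := e2P e2' _ (mem_nth 0 il) _ (mem_nth 0 jl) ij0; rewrite ltNge;
    apply/negP; rewrite negbK.
  rewrite (_ : l`_i - l`_j = (w - l`_j) - (w - l`_i)); last by ring.
  by rewrite (le_trans (ler_cabsD _ _)) // cabsN lerD.
- move=> a /lP al; exists (a, e); first by apply/mapP; exists a.
  by rewrite /open_disc /= normCE subrr cabs0 ltcR.
Qed.

Lemma matfun_interp D B f (p : {poly C}) (q : C -> C) :
  open D -> spectrum B `<=` D -> C1_on D q ->
  (forall w, D w -> f w = p.[w] + (char_poly B).[w] * q w) ->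
  matfun D f B = horner_mx B p.
Proof.
move=> oD BD Cq fE; have [G0 G0B] := encloses_exists oD BD.
rewrite /matfun; case: xgetP => [X _ [G GB ->]|noX].
  exact: contour_matfun_interp GB oD Cq fE.
(* A contour exists, so the default value 0 of [xget] is excluded. *)
by case: (noX (contour_matfun G0 f B)); exists G0.
Qed.

End contour_resolvent.

(** * Divided differences *)

Section newton.
Variable K : numFieldType.
Implicit Types (l s : seq K) (F : nat -> K -> K) (a x : K).

Fixpoint dquos l F := if l is a :: l' then dquos l' (dquo a F) else F.

(** Hermite interpolation of [F 0] at the nodes [l], in Newton's form; repeated nodes are covered
    because [dquo] is filled in at its centre by a derivative. *)
Fixpoint newton_poly l F : {poly K} :=
  if l is a :: l' then (F 0 a)%:P + ('X - a%:P) * newton_poly l' (dquo a F) else 0.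

Lemma newton_polyE l F x :
  F 0 x = (newton_poly l F).[x] + (\prod_(a <- l) ('X - a%:P)).[x] * dquos l F 0 x.
Proof.
elim: l F => [|a l IH] F; first by rewrite /= big_nil !hornerE.
rewrite big_cons /= {1}(dquo_mulE a) IH !hornerE; ring.
Qed.

Definition vanishes l F := forall a j, a \in l -> (j < count_mem a l)%N -> F j a = 0.

(** Dividing by x - a uses up one zero at [a], where the j-th derivative of the quotient is F (j +
    1) a / (j + 1); at other nodes the numerators inherit the zeros of [F]. *)
Lemma vanishes_dquo a l F : vanishes (a :: l) F -> vanishes l (dquo a F).
Proof.
move=> vF b j bl jb.
have b_al : b \in a :: l by rewrite in_cons bl orbT.
have F0 : F 0 a = 0 by apply: vF; rewrite ?mem_head //= eqxx.
rewrite /dquo; case: eqVneq => [ba|ba].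
  rewrite vF ?mul0r ?mem_head //= eqxx add1n ltnS -ba //.
suff -> : dquo_num a F j b = 0 by rewrite mul0r.
have vb i : (i <= j)%N -> F i b = 0.
  move=> ij; apply: vF => //=; rewrite (leq_ltn_trans ij) // ltn_addl //.
elim: j {jb} vb => [|j IH] vb /=; first by rewrite vb // F0 subrr.
rewrite vb // mulr0 IH ?mulr0 ?subr0 // => i ij; exact/vb/leqW.
Qed.

Lemma newton_poly0 l F : vanishes l F -> newton_poly l F = 0.
Proof.
elim: l F => [|a l IH] F //= vF; rewrite (IH _ (vanishes_dquo vF)) mulr0 addr0.
by rewrite vF ?polyC0 ?mem_head //= eqxx.
Qed.

Definition jet_eval (J : seq (K * (nat * K))) F : K :=
  \sum_(t <- J) t.1 * F t.2.1 t.2.2.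

(** The list [J] is chosen before [F]: one jet serves for all functions, in particular for
    compositions with affine maps. *)
Definition is_jet s (Lam : (nat -> K -> K) -> K) := exists J,
  (forall t, t \in J -> t.2.2 \in s) /\ forall F, Lam F = jet_eval J F.

Lemma is_jetD s L1 L2 : is_jet s L1 -> is_jet s L2 -> is_jet s (fun F => L1 F +
  L2 F).
Proof.
move=> [J1 [s1 E1]] [J2 [s2 E2]]; exists (J1 ++ J2); split=> [t|F].
  by rewrite mem_cat => /orP[/s1|/s2].
by rewrite E1 E2 /jet_eval big_cat.
Qed.

Lemma is_jetZ s c L : is_jet s L -> is_jet s (fun F => c * L F).
Proof.
move=> [J [sJ E]]; exists [seq (c * t.1, t.2) | t <- J]; split=> [t|F].
  by move=> /mapP[t' /sJ ? ->].
rewrite E /jet_eval big_map mulr_sumr; apply: eq_bigr => t _; exact: mulrA.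
Qed.

Lemma is_jet_point s k x : x \in s -> is_jet s (fun F => F k x).
Proof.
move=> xs; exists [:: (1, (k, x))]; split=> [t|F].
  by rewrite inE => /eqP ->.
by rewrite /jet_eval big_seq1 mul1r.
Qed.

Lemma eq_is_jet s L1 L2 : L1 =1 L2 -> is_jet s L1 -> is_jet s L2.
Proof. by move=> L12 [J [sJ E]]; exists J; split=> // F; rewrite -L12. Qed.

Lemma is_jet_sum s (I : eqType) (r : seq I) (L : I -> (nat -> K -> K) -> K) :
  (forall i, i \in r -> is_jet s (L i)) -> is_jet s (fun F => \sum_(i <- r) L i F).
Proof.
elim: r => [|i r IH] Lr.
  by exists [::]; split=> // F; rewrite /jet_eval !big_nil.
apply: (@eq_is_jet _ (fun F => L i F + \sum_(j <- r) L j F)) => [F|].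
  by rewrite big_cons.
apply: is_jetD; first by apply: Lr; rewrite mem_head.
by apply: IH => j jr; apply: Lr; rewrite in_cons jr orbT.
Qed.

Lemma is_jet_dquo_point s a k x : a \in s -> x \in s ->
  is_jet s (fun F => dquo a F k x).
Proof.
move=> sa sx; rewrite /dquo; case: eqVneq => [_|xa].
  apply: (@eq_is_jet _ (fun F => k.+1%:R^-1 * F k.+1 a)) => [F|]; first exact: mulrC.
  exact/is_jetZ/is_jet_point.
apply: (@eq_is_jet _ (fun F => ((x - a) ^+ k.+1)^-1 * dquo_num a F k x)) => [F|].
  exact: mulrC.
apply: is_jetZ; elim: k => [|k IH].
  apply: (@eq_is_jet _ (fun F => F 0 x + (-1) * F 0 a)) => [F|].
    by rewrite mulN1r.
  by apply: is_jetD; [|apply: is_jetZ]; exact: is_jet_point.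
apply: (@eq_is_jet _ (fun F => (x - a) ^+ k.+1 * F k.+1 x +
    (- k.+1%:R) * dquo_num a F k x)) => [F|]; first by rewrite mulNr.
by apply: is_jetD; apply: is_jetZ => //; exact: is_jet_point.
Qed.

Lemma is_jet_dquo s a L : a \in s -> is_jet s L -> is_jet s (fun F => L (dquo a F)).
Proof.
move=> sa [J [sJ E]].
apply: (@eq_is_jet _ (fun F => \sum_(t <- J) t.1 * dquo a F t.2.1 t.2.2)) => [F|].
  by rewrite E.
apply: (@is_jet_sum _ _ _ (fun t F => t.1 * dquo a F t.2.1 t.2.2)) => t tJ.
by apply: is_jetZ; apply: is_jet_dquo_point => //; exact: sJ.
Qed.

(** The induction ranges over all linear [phi], because the factor ['X - a%:P] is absorbed into the
    functional applied to the tail. *)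
Lemma is_jet_newton_poly l s (phi : {poly K} -> K) : {subset l <= s} ->
  (forall p q, phi (p + q) = phi p + phi q) -> (forall c p, phi (c *: p) = c *
    phi p) ->
  is_jet s (fun F => phi (newton_poly l F)).
Proof.
elim: l phi => [|a l IH] phi ls phiD phiZ /=.
  exists [::]; split=> // F; rewrite /jet_eval big_nil.
  by rewrite -(scale0r (0 : {poly K})) phiZ mul0r.
apply: (@eq_is_jet _ (fun F => phi 1 * F 0 a +
    phi (('X - a%:P) * newton_poly l (dquo a F)))) => [F|].
  by rewrite phiD -[(F 0 a)%:P]mulr1 mul_polyC phiZ mulrC.
apply: is_jetD; first by apply/is_jetZ/is_jet_point/ls; rewrite mem_head.
apply: (@is_jet_dquo s a (fun F => phi (('X - a%:P) * newton_poly l F))).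
  by apply: ls; rewrite mem_head.
apply: (IH (fun p => phi (('X - a%:P) * p))).
- by move=> b bl; apply: ls; rewrite in_cons bl orbT.
- by move=> p q; rewrite mulrDr phiD.
- by move=> c p; rewrite -scalerAr phiZ.
Qed.

End newton.

Section affine.
Variables (K : fieldType) (n : nat).
Implicit Types (A : 'M[K]_n.+1) (x : K).

Lemma horner_char_poly A x : (char_poly A).[x] = \det (x%:M - A).
Proof.
rewrite /char_poly -[LHS]/(horner_eval x _) -det_map_mx; congr (\det _).
apply/matrixP => i j; rewrite !mxE /= /horner_eval !hornerE.
by rewrite hornerMn hornerX.
Qed.

(** The scalar b cancels in the determinant and t factors out of each row; in this form, without a
    quotient, t = 0 is covered. *)
Lemma char_poly_affine A b t x :
  (char_poly (b%:M + t *: A)).[b + t * x] = t ^+ n.+1 * (char_poly A).[x].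
Proof.
rewrite !horner_char_poly -detZ; congr (\det _).
by rewrite raddfD /= opprD addrACA subrr add0r -scale_scalar_mx -scalerBr.
Qed.

Lemma horner_mx_affine A b t (p : {poly K}) :
  horner_mx A (p \Po (b%:P + t *: 'X)) = horner_mx (b%:M + t *: A) p.
Proof.
elim/poly_ind: p => [|p c IH]; first by rewrite comp_poly0 !rmorph0.
have qE : horner_mx A (b%:P + t *: 'X) = b%:M + t *: A.
  rewrite -mul_polyC rmorphD rmorphM /= !horner_mx_C horner_mx_X.
  by rewrite -mulmxE mul_scalar_mx.
rewrite comp_poly_MXaddC [LHS]rmorphD rmorphM [RHS]rmorphD rmorphM /= IH qE.
by rewrite !horner_mx_C horner_mx_X.
Qed.

End affine.

(** * Matrix functions as Newton polynomials and jets *)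

Section matfun.
Variables (R : realType) (n : nat).
Local Notation C := (CC R).
Implicit Types (D : set C) (A B : 'M[C]_n.+1) (F : nat -> C -> C) (l : seq C).

Lemma family_dquos D l F : open D -> family D F -> family D (dquos l F).
Proof. by move=> oD; elim: l F => [|a l IH] F dF //=; apply/IH/family_dquo. Qed.

Lemma matfun_newton D A F (f : C -> C) l : open D -> spectrum A `<=` D -> family
  D F ->
  (forall x, D x -> f x = F 0 x) -> char_poly A = \prod_(a <- l) ('X - a%:P) ->
  matfun D f A = horner_mx A (newton_poly l F).
Proof.
move=> oD AD dF fF lA.
apply: (@matfun_interp _ _ _ _ _ _ (dquos l F 0)) => //.
  by apply: family_C1; exact: family_dquos.
by move=> w Dw; rewrite fF // lA -newton_polyE.
Qed.

(** The derivatives of x |-> F 0 (b + t x), by the chain rule. *)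
Definition faffine (b t : C) F k x : C := t ^+ k * F k (b + t * x).

Lemma cder_affine (b t x : C) : cder id (fun x : C => b + t * x) x t.
Proof.
have := cderD (cder_cst id x b) (cderZ id_continuous t (cder_io id x)).
by rewrite add0r mulr1.
Qed.

Lemma family_affine D F (b t : C) : family D F ->
  family [set x | D (b + t * x)] (faffine b t F).
Proof.
move=> dF k x Dx; have := cderZ id_continuous (t ^+ k)
  (cder_comp id_continuous (cder_affine b t x) (dF k _ Dx)).
by apply: cder_eq; rewrite /faffine exprS; ring.
Qed.

Lemma affine_preimage_open D (b t : C) : open D -> open [set x : C | D (b + t * x)].
Proof.
move=> oD; apply: open_comp oD => x _.
exact: (cder_continuous (id_continuous _) (cder_affine b t x)).
Qed.

(** The calculus at b + t A becomes a calculus at [A] for the composed function, with the fixed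
    nodes [l] whatever b and t are. *)
Lemma matfun_affine D A F (f : C -> C) l (b t : C) : open D -> family D F ->
  (forall x, D x -> f x = F 0 x) -> char_poly A = \prod_(a <- l) ('X - a%:P) ->
  (forall x, x \in l -> D (b + t * x)) ->
  matfun D f (b%:M + t *: A) = horner_mx A (newton_poly l (faffine b t F)).
Proof.
move=> oD dF fF lA lD; set B := b%:M + t *: A.
have lAP a : spectrum A a <-> a \in l.
  by rewrite /spectrum /= eigenvalue_root_char lA root_prod_XsubC.
have [l' l'B l'P] := char_poly_roots B.
have BD : spectrum B `<=` D.
  move=> y; rewrite /spectrum /= => By.
  (* For t = 0 the only eigenvalue is b, which is in [D] because [l] is not empty. Otherwise an
     eigenvalue y pulls back to (y - b) / t. *)
  have [t0|t0] := eqVneq t 0.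
    have yb : y = b.
      have /eigenvalueP[v vB v0] := By; apply/eqP; rewrite -subr_eq0.
      move: vB; rewrite /B t0 scale0r addr0 mul_mx_scalar => /eqP.
      by rewrite eq_sym -subr_eq0 -scalerBl scaler_eq0 (negbTE v0) orbF.
    case: l lA lD {lAP} => [|x l] lA lD.
      have := size_char_poly A; rewrite lA big_nil size_poly1.
      by [].
    by have := lD x (mem_head _ _); rewrite yb t0 mul0r addr0.
  rewrite eigenvalue_root_char in By.
  pose x := (y - b) / t; have yE : y = b + t * x by rewrite /x mulrC divfK //
    addrC subrK.
  rewrite yE; apply/lD/lAP; rewrite /spectrum /= eigenvalue_root_char.
  have /eqP := By; rewrite yE char_poly_affine => /eqP.
  by rewrite mulf_eq0 expf_eq0 (negbTE t0) andbF.
pose D' : set C := [set x | D (b + t * x)].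
have oD' : open D' := affine_preimage_open oD.
have AD' : spectrum A `<=` D' by move=> a /lAP al; exact: lD.
rewrite (matfun_newton oD BD dF fF l'B).
rewrite -(matfun_newton oD' AD' (family_affine dF) (f := faffine b t F 0) _ lA) //.
rewrite -horner_mx_affine; apply/esym.
(* The cofactor of [char_poly B], pulled back; the power of t comes from [char_poly_affine]. *)
pose q (x : C) := t ^+ n.+1 * dquos l' F 0 (b + t * x).
apply: (@matfun_interp _ _ _ _ _ _ q) => //.
  have Cq := family_C1 (family_affine (family_dquos l' oD dF) (b := b) (t := t)).
  have /= := C1_onM (C1_on_poly D' (t ^+ n.+1)%:P) Cq.
  by under [X in C1_on _ X]eq_fun do rewrite hornerC /faffine expr0 mul1r.
move=> w Dw; rewrite /faffine expr0 mul1r (newton_polyE l') -l'B.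
rewrite char_poly_affine /q horner_comp.
rewrite hornerD hornerC hornerZ hornerX; congr (_ + _).
by rewrite mulrA [_ * t ^+ _]mulrC.
Qed.

Lemma exists_jet A (xi : {scalar 'M[C]_n.+1}) (M : 'M[C]_n.+1) l : 
  exists J : seq (C * (nat * C)), (forall t, t \in J -> t.2.2 \in l) /\
  forall F, xi (M *m horner_mx A (newton_poly l F)) = jet_eval J F.
Proof.
apply: (@is_jet_newton_poly _ l l (fun p => xi (M *m horner_mx A p))) => //.
- by move=> p q; rewrite rmorphD mulmxDr linearD.
- by move=> c p; rewrite linearZ /= -scalemxAr linearZ.
Qed.

End matfun.

(** * Convex hulls *)

Section hull.
Variable R : realType.
Local Notation C := (CC R).
Local Notation RC := (@RC R).
Implicit Types (H S : set C) (a b x y : C) (l : seq C) (r s t : R).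

Definition segment_closed H := forall x y s, H x -> H y -> 0 <= s <= 1 ->
  H (RC (1 - s) * x + RC s * y).

(** Library weights are elements of [R[i]] between 0 and 1, hence real, and sit on the first point;
    here the parameter sits on the second. *)
Lemma convex_setP H : @convex_set R[i] R[i]^o H <-> segment_closed H.
Proof.
split=> [cH x y s Hx Hy /andP[s0 s1]|cH x y k /[!inE] Hx Hy].
  have p0 : 0 <= (RC (1 - s) : R[i]) by rewrite ler0c subr_ge0.
  have p1 : (RC (1 - s) : R[i]) <= 1 by rewrite lecR gerBl.
  have := cH x y (Itv01 p0 p1); rewrite !inE => /(_ Hx Hy).
  have -> // : conv (Itv01 p0 p1) (x : convex_lmodType R[i]^o) y =
      RC (1 - s) * x + RC s * y.
  rewrite /conv /= /RC; congr (_ + _ * _).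
  by rewrite /unstable.onem /= rmorphB rmorph1 opprB addrC subrK.
have kE : (complex.Re k%:num)%:C = k%:num by rewrite RRe_real // ger0_real.
have k0 : 0 <= complex.Re k%:num by rewrite -ler0c kE.
have k1 : complex.Re k%:num <= 1 by rewrite -lecR kE [1%:C]rmorph1.
have := cH x y (1 - complex.Re k%:num) Hx Hy.
rewrite subr_ge0 k1 gerBl k0 opprB [1 + _]addrC subrK => /(_ isT).
have -> // : conv k (x : convex_lmodType R[i]^o) y =
  RC (complex.Re k%:num) * x + RC (1 - complex.Re k%:num) * y.
by rewrite /conv /= /unstable.onem /RC rmorphB /= kE.
Qed.

Lemma segment_closed_hull S : segment_closed (convex_hull S).
Proof.
move=> x y s Sx Sy s01 H [/convex_setP cH SH]; apply: (cH) => //.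
  by apply: Sx; split; [exact: (iffRL (convex_setP H) cH)|exact: SH].
by apply: Sy; split; [exact: (iffRL (convex_setP H) cH)|exact: SH].
Qed.

Lemma convex_hull_sub S H : segment_closed H -> S `<=` H -> convex_hull S `<=` H.
Proof.
by move=> cH SH; apply: smallest_sub; [exact: (iffRL (convex_setP H) cH)|exact: SH].
Qed.

Lemma sub_convex_hull S : S `<=` convex_hull S.
Proof. exact: sub_gen_smallest. Qed.

(** An iterated image of [0, 1] times the hull of the tail, so that compactness follows from
    continuity. *)
Fixpoint seq_hull a l : set C :=
  if l is b :: l' then (fun p : R * C => RC (1 - p.1) * a + RC p.1 * p.2) @`
    (`[0, 1]%classic `*` seq_hull b l')
  else [set a].

Lemma compact_seq_hull a l : compact (seq_hull a l).
Proof.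
elim: l a => [|b l IH] a /=; first exact: compact_set1.
apply: (@continuous_compact _ C (fun p : R * C => RC (1 - p.1) * a + RC p.1 *
  p.2)); last by apply: compact_setX => //; exact: segment_compact.
apply: continuous_subspaceT => -[s y].
have c1 : {for (s, y), continuous (fun p : R * C => RC p.1)}.
  exact: (cvg_comp _ _ (cvg_fst (F := nbhs s) (G := nbhs y)) (@RtoC_continuous R s)).
have c2 : {for (s, y), continuous (fun p : R * C => p.2)}.
  exact: (cvg_snd (F := nbhs s) (G := nbhs y)).
have c3 : {for (s, y), continuous (fun p : R * C => RC (1 - p.1))}.
  have c4 : {for (s, y), continuous (fun p : R * C => 1 - RC p.1)}.
    exact: (cvgB (cvg_cst _) c1).
  have -> : (fun p : R * C => RC (1 - p.1)) = fun p => 1 - RC p.1.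
    by apply/funext => p; rewrite /RC rmorphB rmorph1.
  exact: c4.
exact: (cvgD (cvgM c3 (cvg_cst _)) (cvgM c1 c2)).
Qed.

Lemma seq_hull_segment_closed a l : segment_closed (seq_hull a l).
Proof.
elim: l a => [|b l IH] a /= x y r.
  by move=> -> -> _; rewrite -mulrDl /RC -rmorphD subrK rmorph1 mul1r.
move=> [[s1 y1] [/= s1I y1H] <-] [[s2 y2] [/= s2I y2H] <-] /andP[r0 r1].
move: s1I s2I; rewrite !in_itv /= => /andP[s10 s11] /andP[s20 s21].
(* The total weight on the tail; the two tail points are then mixed with the renormalised weight r
   s2 / q. *)
pose q := (1 - r) * s1 + r * s2.
have q0 : 0 <= q by rewrite addr_ge0 // mulr_ge0 // subr_ge0.
have q1 : q <= 1.
  have : (1 - r) * s1 <= (1 - r) * 1 by rewrite ler_wpM2l // subr_ge0.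
  have : r * s2 <= r * 1 by rewrite ler_wpM2l.
  rewrite /q; lra.
(* With no weight on the tail, any tail point serves as second component. *)
have [qz|qz] := eqVneq q 0.
  have /andP[/eqP e1 /eqP e2] : ((1 - r) * s1 == 0) && (r * s2 == 0).
    by rewrite -paddr_eq0 ?mulr_ge0 ?subr_ge0 //; apply/eqP.
  exists (0, y1); first by split; rewrite //= in_itv /= lexx ler01.
  rewrite /= /RC subr0 rmorph0 mul0r addr0 rmorph1 mul1r !mulrDr !mulrA -!rmorphM /=.
  rewrite e1 e2 rmorph0 !mul0r !addr0 -mulrDl -rmorphD.
  have -> : (1 - r) * (1 - s1) + r * (1 - s2) = 1 by lra.
  by rewrite rmorph1 mul1r.
exists (q, RC (1 - r * s2 / q) * y1 + RC (r * s2 / q) * y2).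
  split; rewrite /= ?in_itv /= ?q0 //; apply: IH => //.
  rewrite divr_ge0 ?mulr_ge0 //= ler_pdivrMr ?mul1r; last by rewrite lt_def qz.
  by rewrite /q lerDr mulr_ge0 // subr_ge0.
have qC : RC q != 0 by rewrite -cabs_eq0 cabsR normr_eq0.
rewrite /= mulrDr !mulrA /RC -!rmorphM /=.
have -> : q * (1 - r * s2 / q) = (1 - r) * s1 by rewrite mulrBr mulr1 [q *
  _]mulrC divfK // /q addrK.
have -> : q * (r * s2 / q) = r * s2 by rewrite mulrC divfK.
rewrite !mulrDr !mulrA -!rmorphM /= addrACA -mulrDl -rmorphD; congr (_ * _ + _).
by congr (_%:C); rewrite /q; ring.
Qed.

Lemma mem_seq_hull a l x : x \in a :: l -> seq_hull a l x.
Proof.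
elim: l a x => [|b l IH] a x; first by rewrite inE => /eqP ->.
have [z zH] : exists z, seq_hull b l z by exists b; apply: IH; rewrite mem_head.
rewrite in_cons => /orP[/eqP ->|/IH xH] /=.
  exists (0, z); first by split; rewrite //= in_itv /= lexx ler01.
  by rewrite /= /RC subr0 rmorph1 rmorph0 mul1r mul0r addr0.
exists (1, x); first by split; rewrite //= in_itv /= lexx ler01.
by rewrite /= /RC subrr rmorph1 rmorph0 mul1r mul0r add0r.
Qed.

Lemma seq_hull_sub a l H : segment_closed H -> (forall x, x \in a :: l -> H x) ->
  seq_hull a l `<=` H.
Proof.
move=> cH; elim: l a => [|b l IH] a lH x /=; first by move=> ->; exact/lH/mem_head.
move=> [[s y] [/= sI yH] <-]; apply: cH.
- by apply: lH; rewrite mem_head.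
- by apply: (IH b) => // w wl; apply: lH; rewrite in_cons wl orbT.
- by move: sI; rewrite in_itv.
Qed.

Lemma convex_hull_seq a l : convex_hull [set` a :: l] = seq_hull a l.
Proof.
apply/seteqP; split.
  by apply: convex_hull_sub; [exact: seq_hull_segment_closed|move=> x; exact:
    mem_seq_hull].
apply: seq_hull_sub; first exact: segment_closed_hull.
by move=> x xl; exact: sub_convex_hull.
Qed.

End hull.

(** * The error bound *)

Section bound.
Variable R : realType.
Local Notation C := (CC R).
Local Notation RC := (@RC R).
Implicit Types (D H : set C) (F : nat -> C -> C) (J : seq (C * (nat * C))).

(* J evaluated on the derivatives of x |-> F 0 ((1 - t) mu + t x). *)
Definition jet_conv J F (t : R) (mu : C) : C :=
  jet_eval J (faffine (RC (1 - t) * mu) (RC t) F).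

Lemma dquo_bound D H F J (a : C) (m : nat) (K : R) : open D -> family D F ->
  segment_closed H -> H a ->
  (forall t mu e, 0 <= t <= 1 -> H mu -> e \in J -> D (RC (1 - t) * mu + RC t *
    e.2.2)) ->
  (forall t mu, 0 <= t <= 1 -> H mu ->
     cabs (jet_conv J (fun k => F (m.+1 + k)%N) t mu) <= K) ->
  forall t mu, 0 <= t <= 1 -> H mu ->
    cabs (jet_conv J (fun k => dquo a F (m + k)%N) t mu) <= K / m.+1%:R.
Proof.
move=> oD dF cH Ha HD FK t mu tI Hmu.
have RCc : continuous RC := @RtoC_continuous R.
have dQ := family_dquo a oD dF; set Q := dquo a F in dQ *.
have [t0 t1] := andP tI.
(* Contracting (1 - t) mu + t x towards [a] by the factor s gives (1 - s t) mu' + s t x, where mu'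
   is the mean of [a] and [mu] with weights 1 - s and s (1 - t), divided by 1 - s t. *)
have point (s : R) : 0 <= s <= 1 -> exists2 mu', H mu' &
    RC (1 - s * t) * mu' = RC (1 - s) * a + RC s * (RC (1 - t) * mu).
  move=> /andP[s0 s1]; have st1 : s * t <= 1 by rewrite mulr_ile1.
  (* In this case s = t = 1 and mu' has coefficient zero, so any point of [H] will do. *)
  have [st|st] := eqVneq (s * t) 1.
    exists mu => //; have sE : s = 1.
      apply/eqP; rewrite eq_le s1 -st -[leRHS]mulr1 ler_wpM2l //.
    have tE : t = 1 by move: st; rewrite sE mul1r.
    by rewrite st sE tE /RC subrr rmorph0 !mul0r mulr0 addr0.
  have q0 : 0 < 1 - s * t by rewrite subr_gt0 lt_def eq_sym st.
  pose r := s * (1 - t) / (1 - s * t).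
  exists (RC (1 - r) * a + RC r * mu).
    apply: cH => //; rewrite divr_ge0 ?mulr_ge0 ?subr_ge0 // ler_pdivrMr //.
    by rewrite mul1r mulrBr mulr1 lerD2r.
  rewrite mulrDr !mulrA /RC -!rmorphM /=.
  have -> : (1 - s * t) * (1 - r) = 1 - s by rewrite /r; field; rewrite gt_eqF.
  by have -> : (1 - s * t) * r = s * (1 - t) by rewrite /r; field; rewrite gt_eqF.
pose y (e : C * (nat * C)) := RC (1 - t) * mu + RC t * e.2.2.
pose w e s := a + RC s * (y e - a).
have wE e s mu' : RC (1 - s * t) * mu' = RC (1 - s) * a + RC s * (RC (1 - t) * mu) ->
    w e s = RC (1 - s * t) * mu' + RC (s * t) * e.2.2.
  by move=> ->; rewrite /w /y /RC !rmorphB !rmorphM rmorph1; ring.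
have st01 (s : R) : 0 <= s <= 1 -> 0 <= s * t <= 1.
  by move=> /andP[s0 s1]; rewrite mulr_ge0 // mulr_ile1.
have wD e s : e \in J -> 0 <= s <= 1 -> D (w e s).
  move=> eJ sI; have [mu' Hmu' muE] := point s sI.
  by rewrite (wE e s mu' muE); apply: HD => //; exact: st01.
(* The power of s combines s ^ (m + 1) with the chain rule factor of order [e.2.1]. *)
pose psi1 (e : C * (nat * C)) s := RC s ^+ (m + e.2.1).+1 * Q (m + e.2.1)%N (w e s).
pose psi1' (e : C * (nat * C)) s := RC s ^+ (m + e.2.1) * F (m + e.2.1).+1 (w e s).
pose c (e : C * (nat * C)) := e.1 * RC t ^+ e.2.1.
have dpsi1 e s : e \in J -> 0 <= s <= 1 -> cder RC (psi1 e) s (psi1' e s).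
  move=> eJ sI; have Dw := wD e s eJ sI.
  have dw : cder RC (w e) s (y e - a).
    have := cderD (cder_cst RC s a)
      (cderM RCc (cder_io RC s) (cder_cst RC s (y e - a))).
    by rewrite mulr0 addr0 mul1r add0r.
  have := cderM RCc (cderX RCc (m + e.2.1).+1 (cder_io RC s))
    (cder_comp RCc dw (dQ (m + e.2.1)%N _ Dw)).
  apply: cder_eq; rewrite /psi1' (dquo_derivE a F) -/Q /= mul1r exprS /w.
  ring.
(* psi s = s^(m+1) J[Q^(m) o a_s], whose derivative is s^m J[F^(m+1) o a_s],
   where a_s is the affine map x |-> a + s ((1 - t) mu + t x - a). *)
pose psi s := \sum_(e <- J) c e * psi1 e s.
have psi1E : psi 1 = jet_conv J (fun k => Q (m + k)%N) t mu.
  apply: eq_bigr => e _; rewrite /psi1 /c /faffine /w -/(y e) /= /RC rmorph1.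
  by rewrite expr1n !mul1r [a + _]addrC subrK mulrA.
have psi0E : psi 0 = 0.
  by rewrite /psi big1 // => e _; rewrite /psi1 /RC rmorph0 expr0n mul0r mulr0.
(* The majorant K s ^ (m + 1) / (m + 1) has derivative K s ^ m; this is the source of the factor 1 /
   (m + 1). *)
suff : cabs (psi 1 - psi 0) <= K / m.+1%:R * 1 ^+ m.+1 - K / m.+1%:R * 0 ^+ m.+1.
  by rewrite psi1E psi0E subr0 expr1n expr0n mulr0 mulr1 subr0.
apply: (@mean_value R psi (fun s => \sum_(e <- J) c e * psi1' e s)
  (fun s => K / m.+1%:R * s ^+ m.+1) (fun s => K * s ^+ m)).
- move=> s sI; apply: (@cder_sum _ _ RC _ J (fun e s => c e * psi1 e s)
    (fun e => c e * psi1' e s) s) => e eJ.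
  by apply: (cderZ RCc); exact: dpsi1.
- move=> s sI; apply: cder_is_derive.
  have := cderZ (@id_continuous R) (K / m.+1%:R) (cderX (@id_continuous R) m.+1
    (cder_io id s)).
  apply: cder_eq; rewrite /= mul1r -[s ^+ m *+ _]mulr_natl mulrA divfK ?pnatr_eq0 //.
- move=> s sI; have [mu' Hmu' muE] := point s sI; have [s0 s1] := andP sI.
  have -> : \sum_(e <- J) c e * psi1' e s =
      RC s ^+ m * jet_conv J (fun k => F (m.+1 + k)%N) (s * t) mu'.
    rewrite mulr_sumr; apply: eq_bigr => e _.
    rewrite /psi1' /c (wE e s mu' muE) /faffine addSn exprD /RC rmorphM exprMn.
    ring.
  rewrite cabsM cabsX cabsR ger0_norm // mulrC ler_wpM2r ?exprn_ge0 //.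
  by apply: FK => //; exact: st01.
Qed.

(** Removing a node that has i nodes after it costs the factor 1 / (m + i + 1); the product of these
    factors is m! / (m + size l)!. *)
Lemma dquos_bound D H F J l (m : nat) (K : R) : open D -> family D F ->
  segment_closed H -> (forall a, a \in l -> H a) ->
  (forall t mu e, 0 <= t <= 1 -> H mu -> e \in J -> D (RC (1 - t) * mu + RC t *
    e.2.2)) ->
  (forall t mu, 0 <= t <= 1 -> H mu ->
     cabs (jet_conv J (fun k => F (m + size l + k)%N) t mu) <= K) ->
  forall t mu, 0 <= t <= 1 -> H mu ->
    cabs (jet_conv J (fun k => dquos l F (m + k)%N) t mu) <= K * m`!%:R / (m +
      size l)`!%:R.
Proof.
move=> oD dF cH lH HD; elim: l F K dF lH => [|a l IH] F K dF lH FK t mu tI Hmu /=.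
  have -> : K * m`!%:R / (m + 0)`!%:R = K.
    by rewrite addn0 mulfK // pnatr_eq0 -lt0n fact_gt0.
  by have := FK t mu tI Hmu; rewrite /= addn0.
have dQ := family_dquo a oD dF.
have := IH _ (K / (m + size l).+1%:R) dQ _ _ t mu tI Hmu.
have -> : K / (m + size l).+1%:R * m`!%:R / (m + size l)`!%:R =
    K * m`!%:R / (m + (size l).+1)`!%:R :> R.
  by rewrite addnS factS natrM invfM -!mulrA; congr (_ * _); rewrite mulrCA.
apply; first by move=> b bl; apply: lH; rewrite in_cons bl orbT.
apply: (dquo_bound oD dF cH _ HD); first by apply: lH; rewrite mem_head.
by move=> t' mu' tI' Hmu'; have := FK t' mu' tI' Hmu'; rewrite /= addnS.
Qed.

End bound.

(** * The interpolation error as a matrix identity *)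

Section remainder.
Variables (R : realType) (n : nat).
Local Notation C := (CC R).
Implicit Types (D : set C) (A : 'M[C]_n.+1) (F : nat -> C -> C) (l z : seq C).
Implicit Types (u v p : {poly C}) (f : C -> C).

Lemma family_unique D F G : open D -> family D F -> family D G ->
  (forall x, D x -> F 0 x = G 0 x) -> forall k x, D x -> F k x = G k x.
Proof.
move=> oD dF dG FG k x Dx.
by rewrite -(family_cderiven oD dF (f := F 0)) // (family_cderiven oD dG FG).
Qed.

Lemma poly_neq0_open v : open [set w : C | v.[w] != 0].
Proof.
have -> : [set w : C | v.[w] != 0] = horner v @^-1` [set y : C | y != 0] by [].
apply: open_comp => [w _|].
  exact: (cder_continuous (id_continuous _) (cder_horner v w)).
move=> y /= y0; apply/nbhsC; exists (cabs y) => [|w]; first by rewrite cabs_gt0.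
by apply: contraTneq => ->; rewrite sub0r cabsN ltxx.
Qed.

Lemma horner_mxC A p q : horner_mx A p *m horner_mx A q = horner_mx A q *m
  horner_mx A p.
Proof. exact: comm_horner_mx2. Qed.

(** Near a node u = v r, so Leibniz's formula gives the derivatives of [u] from those of r;
    interpolation replaces the latter by derivatives of [f] up to the multiplicity. *)
Lemma interp_vanishes f u v z : (forall w, w \in z -> v.[w] != 0) ->
  interpolates (fun w => u.[w] / v.[w]) f z ->
  vanishes z (fsub (fmul (fpoly v) (fun k => cderiven k f)) (fpoly u)).
Proof.
move=> zv int a j az ja; rewrite /fsub.
set V : set C := [set w | v.[w] != 0].
have oV : open V := @poly_neq0_open v.
have dr : family V (frat u v) := @family_frat _ u v.
have Va : V a := zv a az.
have -> : fpoly u j a = fmul (fpoly v) (frat u v) j a.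
  apply: (family_unique oV (@family_poly _ V u) (family_fmul (@family_poly _ V
    v) dr)) => //.
  move=> x /= vx; rewrite /fmul big_ord1 /fpoly /frat expr1 /= mulr1n.
  by rewrite mulrC divfK.
rewrite /fmul -sumrB big1 // => i _; rewrite -mulrnBl -mulrBr.
have -> : frat u v (j - i)%N a = cderiven (j - i) f a.
  rewrite -(int a (j - i)%N az) ?(leq_ltn_trans (leq_subr _ _)) //.
  by apply/esym/(family_cderiven oV dr) => // x Vx; rewrite /frat expr1.
by rewrite subrr mulr0 mul0rn.
Qed.

(** Bezout gives b chi + a v = 1 with chi = [char_poly A]. Hence a(A) inverts v(A), and u / v = u a
    + chi (u b / v) has the shape that determines the contour integral. *)
Lemma matfun_rational A u v : (forall w, spectrum A w -> v.[w] != 0) ->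
  horner_mx A v \in unitmx /\
  matfun [set w : C | v.[w] != 0] (fun w => u.[w] / v.[w]) A =
  horner_mx A u *m invmx (horner_mx A v).
Proof.
move=> Av; have : coprimep (char_poly A : {poly R[i]}) v.
  apply/Pdiv.ClosedField.coprimepP => w wA.
  by apply: Av; rewrite /spectrum /= eigenvalue_root_char.
move=> /Bezout_eq1_coprimepP[[b a] /= ab].
have va : horner_mx A v *m horner_mx A a = 1%:M.
  have := congr1 (horner_mx A) ab; rewrite rmorphD !rmorphM /= Cayley_Hamilton.
  by rewrite mulr0 add0r rmorph1 => H; rewrite horner_mxC; exact: H.
have [vU _] := mulmx1_unit va; split=> //.
have -> : invmx (horner_mx A v) = horner_mx A a.
  by rewrite -[LHS]mulmx1 -va mulKmx.
rewrite (@matfun_interp _ _ _ _ _ (u * a) (fun w => (u * b).[w] / v.[w])).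
- by rewrite rmorphM.
- exact: poly_neq0_open.
- exact: Av.
- have := family_C1 (@family_frat _ (u * b) v).
  by under [X in C1_on _ X]eq_fun do rewrite /frat expr1.
- move=> w /= vw.
  have abw : b.[w] * (char_poly A).[w] + a.[w] * v.[w] = 1.
    by rewrite -!hornerM -hornerD ab hornerC.
  rewrite [(u * a).[w]]hornerM [(u * b).[w]]hornerM -[LHS]mulr1 -abw.
  by field; exact: vw.
Qed.

(** The contour integral of p is computed twice, from p = p + chi 0 and from p = 0 + chi q; this
    avoids showing that q is a polynomial. *)
Lemma poly_multiple_horner_mx D A p (q : C -> C) : open D -> spectrum A `<=` D ->
  C1_on D q -> (forall w, D w -> p.[w] = (char_poly A).[w] * q w) ->
  horner_mx A p = 0.
Proof.
move=> oD AD Cq pq.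
have <- : matfun D (horner p) A = horner_mx A p.
  apply: (@matfun_interp _ _ _ _ _ _ (horner 0)) => //; first exact: C1_on_poly.
  by move=> w _; rewrite horner0 mulr0 addr0.
rewrite (matfun_interp oD AD Cq (p := 0)) ?rmorph0 // => w Dw.
by rewrite pq // horner0 add0r.
Qed.

(** With pf and pH the Newton polynomials of f and G_N at the eigenvalues, v pf - u - Omega pH is on
    D a multiple of [char_poly A], hence vanishes at [A]. Since polynomials in [A] commute, f(A) -
    r(A) can be isolated. *)
Lemma interp_remainder D A f u v z l : open D -> analytic_on D f ->
  spectrum A `<=` D -> char_poly A = \prod_(a <- l) ('X - a%:P) ->
  (forall w, w \in z -> v.[w] != 0) ->
  (forall w, spectrum A w -> v.[w] != 0) ->
  interpolates (fun w => u.[w] / v.[w]) f z ->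
  let Omega := \prod_(a <- z) ('X - a%:P) in
  let h := fsub (fmul (fpoly v) (fun k => cderiven k f)) (fpoly u) in
  matfun D f A - matfun [set w : C | v.[w] != 0] (fun w => u.[w] / v.[w]) A =
  horner_mx A Omega *m invmx (horner_mx A v) *m
  horner_mx A (newton_poly l (dquos z h)).
Proof.
move=> oD fan AD lA zv Av int Om h.
have df : family D (fun k => cderiven k f) := analytic_family oD fan.
have dh : family D h.
  by apply: family_fsub; [apply: family_fmul => //; exact: family_poly|exact:
    family_poly].
have [vU ->] := matfun_rational u Av.
rewrite (matfun_newton oD AD df (f := f) _ lA) //.
set pf := newton_poly l (fun k => cderiven k f); set pH := newton_poly l _.
pose qf := dquos l (fun k => cderiven k f) 0; pose qH := dquos l (dquos z h) 0.
have Cqf : C1_on D qf by apply/family_C1/family_dquos.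
have CqH : C1_on D qH by apply/family_C1/family_dquos/family_dquos.
have hE w : h 0 w = Om.[w] * dquos z h 0 w.
  rewrite [LHS](newton_polyE z) newton_poly0 ?horner0 ?add0r //.
  exact: interp_vanishes.
have : horner_mx A (v * pf - u - Om * pH) = 0.
  apply: (@poly_multiple_horner_mx D _ _ (fun w => Om.[w] * qH w - v.[w] * qf
    w)) => //.
    by apply: C1_onB; apply: C1_onM => //; exact: C1_on_poly.
  move=> w Dw.
  have hw : h 0 w = v.[w] * f w - u.[w].
    by rewrite /h /fsub /fmul big_ord1 /fpoly /= mulr1n.
  have fw : f w = pf.[w] + (char_poly A).[w] * qf w.
    by rewrite lA -(newton_polyE l (fun k => cderiven k f)).
  have Hw : dquos z h 0 w = pH.[w] + (char_poly A).[w] * qH w.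
    by rewrite lA -(newton_polyE l (dquos z h)).
  move: hw; rewrite hE Hw fw => hw.
  rewrite !hornerD !hornerN !hornerM.
  have -> : v.[w] * pf.[w] - u.[w] = v.[w] * (pf.[w] + (char_poly A).[w] * qf w)
    - u.[w]
    - v.[w] * ((char_poly A).[w] * qf w) by ring.
  by rewrite -hw; ring.
rewrite !rmorphB !rmorphM /= => /eqP; rewrite subr_eq0 => /eqP vE.
have vM : horner_mx A v *m (horner_mx A pf - horner_mx A u *m invmx (horner_mx A
  v)) =
    horner_mx A Om *m horner_mx A pH.
  rewrite mulmxBr mulmxA [horner_mx A v *m horner_mx A u]horner_mxC.
  by rewrite -mulmxA mulmxV // mulmx1.
rewrite -[LHS](mulKmx vU) vM !mulmxA; congr (_ *m _).
rewrite -[LHS]mulmx1 -(mulmxV vU) !mulmxA; congr (_ *m _).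
by rewrite -!mulmxA [horner_mx A Om *m horner_mx A v]horner_mxC mulKmx.
Qed.

End remainder.

(** * Attainment of the maximum *)

Section maximum.
Variable R : realType.
Local Notation C := (CC R).
Local Notation RC := (@RC R).

Lemma jet_conv_continuous D F (J : seq (C * (nat * C))) t mu : family D F ->
  (forall e, e \in J -> D (RC (1 - t) * mu + RC t * e.2.2)) ->
  {for (t, mu), continuous (fun p : R * C => jet_conv J F p.1 p.2)}.
Proof.
move=> dF; rewrite /jet_conv /jet_eval; elim: J => [|e J IH] JD.
  have -> : (fun p : R * C => \sum_(e <- [::]) e.1 *
      faffine (RC (1 - p.1) * p.2) (RC p.1) F e.2.1 e.2.2) = fun=> 0.
    by apply/funext => p; rewrite big_nil.
  exact: cst_continuous.
have -> : (fun p : R * C => \sum_(i <- e :: J) i.1 *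
      faffine (RC (1 - p.1) * p.2) (RC p.1) F i.2.1 i.2.2) = fun p => e.1 *
      faffine (RC (1 - p.1) * p.2) (RC p.1) F e.2.1 e.2.2 +
    \sum_(i <- J) i.1 * faffine (RC (1 - p.1) * p.2) (RC p.1) F i.2.1 i.2.2.
  by apply/funext => p; rewrite big_cons.
have cJ := IH (fun i iJ => JD i (mem_behead (s := e :: J) iJ)).
have De := JD e (mem_head _ _).
have c1 : {for (t, mu), continuous (fun p : R * C => RC p.1)}.
  exact: (cvg_comp _ _ (cvg_fst (F := nbhs t) (G := nbhs mu)) (@RtoC_continuous
    R t)).
have c2 : {for (t, mu), continuous (fun p : R * C => p.2)}.
  exact: (cvg_snd (F := nbhs t) (G := nbhs mu)).
have c3 : {for (t, mu), continuous (fun p : R * C => RC (1 - p.1))}.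
  have c4 : {for (t, mu), continuous (fun p : R * C => 1 - RC p.1)}.
    exact: (cvgB (cvg_cst _) c1).
  have -> : (fun p : R * C => RC (1 - p.1)) = fun p => 1 - RC p.1.
    by apply/funext => p; rewrite /RC rmorphB rmorph1.
  exact: c4.
have cw : {for (t, mu), continuous (fun p : R * C => RC (1 - p.1) * p.2 + RC p.1
  * e.2.2)}.
  exact: (cvgD (cvgM c3 c2) (cvgM c1 (cvg_cst _))).
have cF : {for (t, mu), continuous (fun p : R * C =>
    F e.2.1 (RC (1 - p.1) * p.2 + RC p.1 * e.2.2))}.
  exact: (cvg_comp _ _ cw (cder_continuous (id_continuous _) (dF e.2.1 _ De))).
have cX : {for (t, mu), continuous (fun p : R * C => RC p.1 ^+ e.2.1)}.
  have cx := cder_continuous (id_continuous (RC t))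
    (cderX (@id_continuous C) e.2.1 (cder_io (@id C) (RC t))).
  exact: (cvg_comp _ _ c1 cx).
exact: (cvgD (cvgM (cvg_cst _) (cvgM cX cF)) cJ).
Qed.

Lemma jet_conv_max D F (J : seq (C * (nat * C))) (a : C) (s : seq C) : family D F ->
  (forall t mu e, 0 <= t <= 1 -> seq_hull a s mu -> e \in J ->
     D (RC (1 - t) * mu + RC t * e.2.2)) ->
  exists t0 mu0, [/\ 0 <= t0 <= 1, seq_hull a s mu0 &
    forall t mu, 0 <= t <= 1 -> seq_hull a s mu ->
      cabs (jet_conv J F t mu) <= cabs (jet_conv J F t0 mu0)].
Proof.
move=> dF JD; pose f (p : R * C) := cabs (jet_conv J F p.1 p.2).
have [|||[t0 mu0]] := @compact_EVT_max _ R f (`[0, 1]%classic `*` seq_hull a s).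
- exists (0, a); split; first by rewrite /= in_itv /= lexx ler01.
  by apply: mem_seq_hull; rewrite mem_head.
- by apply: compact_setX; [exact: segment_compact|exact: compact_seq_hull].
- apply: continuous_in_subspaceT => -[t mu]; rewrite inE => -[] /=.
  rewrite in_itv /= => tI muH.
  have cj := jet_conv_continuous dF (fun e => JD t mu e tI muH).
  exact: (cvg_comp _ _ cj (@cabs_continuous R _)).
rewrite inE => -[] /=; rewrite in_itv /= => t0I mu0H fmax.
exists t0, mu0; split=> // t mu tI muH; apply: (fmax (t, mu)).
by rewrite inE; split; rewrite //= in_itv.
Qed.

End maximum.

Theorem theorem11 (R : realType) (n N L M : nat) (A : 'M[R[i]]_n.+1)
    (z : N.-tuple R[i]) (D : set R[i]) (f : R[i] -> R[i]) (u v : {poly R[i]})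
    (xi : {scalar 'M[R[i]]_n.+1}) :
  open (D : set R[i]^o) ->
  convex_hull (spectrum A `|` [set` z]) `<=` D ->
  analytic_on D f ->
  (size u <= L.+1)%N -> (size v <= M.+1)%N -> (L < N)%N ->
  interpolates (fun w => u.[w] / v.[w]) f z ->
  (forall w, w \in z -> v.[w] != 0) ->
  (forall w, spectrum A w -> v.[w] != 0) ->
  let Omega : {poly R[i]} := \prod_(a <- z) ('X - a%:P) in
  let fA := matfun D f A in
  let rA := matfun [set w | v.[w] != 0] (fun w => u.[w] / v.[w]) A in
  let E (t : R) (mu : R[i]) := xi (horner_mx A Omega *m invmx (horner_mx A v) *m
    ((N`!%:R : R[i])^-1 *: matfun D (cderiven N (fun w => v.[w] * f w))
       (((1 - t)%:C * mu)%:M + t%:C *: A))) in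
  exists t0 mu0,
    [/\ 0 <= t0 <= 1, convex_hull [set` z] mu0,
        forall t mu, 0 <= t <= 1 -> convex_hull [set` z] mu ->
          `|E t mu| <= `|E t0 mu0| &
        `|xi (fA - rA)| <= `|E t0 mu0|].
Proof.
move=> oD hullD fan su _ LN int zv Av Omega fA rA E.
have hull_convex := @segment_closed_hull R (spectrum A `|` [set` z]).
have AD : spectrum A `<=` D.
  by move=> w Aw; apply: hullD; apply: sub_convex_hull; left.
have zH : convex_hull [set` z] `<=` convex_hull (spectrum A `|` [set` z]).
  by apply: convex_hull_sub => // w zw; apply: sub_convex_hull; right.
have [l lA lP] := @char_poly_roots R n A.
pose P := horner_mx A Omega *m invmx (horner_mx A v).
have [J [Jl JE]] := @exists_jet R n A xi P l.
have JD t mu e : 0 <= t <= 1 -> convex_hull [set` z] mu -> e \in J ->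
    D (RC (1 - t) * mu + RC t * e.2.2).
  move=> tI /zH Hmu /Jl el; apply: hullD; apply: hull_convex => //.
  by apply: sub_convex_hull; left; apply/lP.
pose g := fmul (fpoly v) (fun k => cderiven k f).
have dg : family D g.
  by apply: family_fmul; [exact: family_poly|exact: analytic_family].
pose gN k := g (N + k)%N.
have dgN : family D gN by exact: family_shift.
(* The jet [J] also evaluates (v f)^(N) composed with the affine map; its arguments stay in [D]
   because mu and the eigenvalues lie in the convex hull. *)
have EE t mu : 0 <= t <= 1 -> convex_hull [set` z] mu ->
    E t mu = (N`!%:R)^-1 * jet_conv J gN t mu.
  move=> tI Hmu; rewrite /E -scalemxAr linearZ /= -/P; congr (_ * _).
  rewrite (@matfun_affine R n D A gN _ l) ?JE //.
    move=> x Dx; rewrite /gN addn0; apply: (family_cderiven oD dg) => // w Dw.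
    by rewrite /g /fmul big_ord1 /fpoly /= mulr1n.
  move=> x xl; apply: hullD; apply: hull_convex => //; first exact: zH.
  by apply: sub_convex_hull; left; apply/lP.
clearbody E.
(* There is at least one node, since L < N. *)
have [a [s zE]] : exists a s, (z : seq R[i]) = a :: s.
  case: (tval z) (size_tuple z) => [zN|a s _]; last by exists a, s.
  by move: LN; rewrite -zN.
have hullE : convex_hull [set` z] = seq_hull a s.
  rewrite -convex_hull_seq; congr convex_hull.
  by apply/seteqP; split=> w /=; rewrite -zE.
have [t0 [mu0 [t0I mu0H max]]] : exists t0 mu0, [/\ 0 <= t0 <= 1,
    convex_hull [set` z] mu0 & forall t mu, 0 <= t <= 1 -> convex_hull [set` z] mu ->
      cabs (jet_conv J gN t mu) <= cabs (jet_conv J gN t0 mu0)].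
  by rewrite hullE; apply: (jet_conv_max dgN) => t mu e; rewrite -hullE; exact: JD.
have normE t mu : 0 <= t <= 1 -> convex_hull [set` z] mu ->
    `|E t mu| = (cabs (jet_conv J gN t mu) / N`!%:R)%:C.
  by move=> tI Hmu; rewrite EE // normCE cabsM cabsV cabs_nat mulrC.
exists t0, mu0; split; [exact: t0I|exact: mu0H|move=> t mu tI Hmu|].
  rewrite (normE t mu tI Hmu) (normE t0 mu0 t0I mu0H) lecR.
  by rewrite ler_wpM2r ?invr_ge0 // max.
rewrite (normE t0 mu0 t0I mu0H) normCE lecR.
pose h := fsub g (fpoly u).
have dh : family D h by apply: family_fsub => //; exact: family_poly.
have remE : fA - rA = P *m horner_mx A (newton_poly l (dquos z h)).
  exact: (interp_remainder oD fan AD lA zv Av int).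
have zhull w : w \in (z : seq R[i]) -> convex_hull [set` z] w.
  by move=> zw; exact: sub_convex_hull.
have az : a \in (z : seq R[i]) by rewrite zE mem_head.
(* At t = 1 the affine map is the identity for every mu, so the choice of the node [a] is
   arbitrary. *)
have -> : xi (fA - rA) = jet_conv J (fun k => dquos z h (0 + k)%N) 1 a.
  rewrite remE JE; apply: eq_bigr => e _.
  by rewrite /faffine /RC subrr rmorph0 rmorph1 expr1n mul0r add0r !mul1r.
(* The degree of [u] is at most L < N, so its derivatives of order N and above vanish. *)
have hgN : (fun k => h (0 + size z + k)%N) = gN.
  apply/funext => k; apply/funext => x; rewrite add0n size_tuple /h /fsub /gN.
  rewrite /fpoly derivn_poly0 ?horner0 ?subr0 //.
  by rewrite (leq_trans su) // (leq_trans LN) // leq_addr.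
(* Order m = 0 with all N nodes turns the constant into 1 / N!. *)
have := @dquos_bound R D (convex_hull [set` z]) h J z 0 _ oD dh
  (@segment_closed_hull R _) zhull JD.
rewrite hgN => /(_ _ max 1 a); rewrite ler01 lexx => /(_ isT (zhull a az)).
by rewrite fact0 mulr1 add0n size_tuple.
Qed.
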